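(* Consider a functional PTS specification, its EPTS and its Dedukti encoding. Let $\Gamma$ be an EPTS context and $A$ an EPTS term with $\Gamma\vdash A\ type$, and let $M$ be a Dedukti term with $[\![\Gamma]\!]\vdash_{DK}M:T$, where either $\Gamma\vdash A:s_A$ and $T=\mathbf{El}_{s_A}[\![A]\!]$, or $A$ is a sort and $T=\mathbf U_A$. Let $NF_\beta(M)$ be the $\beta$-normal form of $M$. Then $NF_\beta(M)$ is an invertible form, $\Gamma\vdash\lfloor NF_\beta(M)\rfloor:A$, and $M\hookrightarrow_\beta^*NF_\beta(M)\equiv_H[\![\lfloor NF_\beta(M)\rfloor]\!]$.
   Context: Functional PTS specification $(\mathcal S,\mathcal A,\mathcal R)$: $\mathcal A\subseteq\mathcal S^2$ functional, $\mathcal R\subseteq\mathcal S^3$ functional in its first two components; $s$ is a top-sort if no $(s,s')\in\mathcal A$. EPTS terms $x\mid s\mid\Pi_{s_1,s_2}(A,x.B)\mid\lambda_{s_1,s_2}(A,x.B,x.M)\mid@_{s_1,s_2}(A,x.B,M,N)$; reduction is the context closure of $@_{s_1,s_2}(A,x.B,\lambda_{s_1,s_2}(A',x.B',x.M),N)\hookrightarrow M\{N/x\}$ for $(s_1,s_2,s_3)\in\mathcal R$, $\equiv$ its equivalence. EPTS typing: empty context well-formed; $\Gamma\vdash A:s$, $x\notin\Gamma$ give $\Gamma,x:A$ well-formed; (Conv) $\Gamma\vdash M:A$, $\Gamma\vdash B:s$, $A\equiv B$ give $\Gamma\vdash M:B$; (Sort) $\Gamma$ well-formed, $(s_1,s_2)\in\mathcal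 A$ give $\Gamma\vdash s_1:s_2$; (Var); for $(s_1,s_2,s_3)\in\mathcal R$: (Prod) $\Gamma\vdash A:s_1$, $\Gamma,x:A\vdash B:s_2$ give $\Gamma\vdash\Pi_{s_1,s_2}(A,x.B):s_3$; (Abs) plus $\Gamma,x:A\vdash M:B$ gives $\Gamma\vdash\lambda_{s_1,s_2}(A,x.B,x.M):\Pi_{s_1,s_2}(A,x.B)$; (App) $\Gamma\vdash A:s_1$, $\Gamma,x:A\vdash B:s_2$, $\Gamma\vdash N:A$, $\Gamma\vdash M:\Pi_{s_1,s_2}(A,x.B)$ give $\Gamma\vdash@_{s_1,s_2}(A,x.B,M,N):B\{N/x\}$. $\Gamma\vdash A\ type$ means $\Gamma\vdash A:s$ for some sort $s$, or $A$ is a (top-)sort and $\Gamma$ is well-formed. Sorts of types are unique. Dedukti: $\lambda\Pi$-calculus with constants $c[\Delta]:A$ of fixed arity (applications $c\,\vec M$), conversion modulo $\beta$ and rewrite rules. Theory $(\Sigma_{EPTS},\mathscr R_{EPTS})$: $\mathbf U_s:\mathtt{TYPE}$, $\mathbf{El}_s[A:\mathbf U_s]:\mathtt{TYPE}$ ($s\in\mathcal S$); $\mathbf u_{s_1}:\mathbf U_{s_2}$ with rule $\mathbf{El}_{s_2}\mathbf u_{s_1}\hookrightarrow\mathbf U_{s_1}$ ($(s_1,s_2)\in\mathcal A$); for $(s_1,s_2,s_3)\in\mathcal R$: $\mathbf{Prod}_{s_1,s_2}[A:\mathbf U_{s_1};B:\mathbf{El}_{s_1}A\to\mathbf U_{s_2}]:\mathbf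 U_{s_3}$, $\mathbf{abs}_{s_1,s_2}[A;B;M:\Pi x:\mathbf{El}_{s_1}A.\mathbf{El}_{s_2}(Bx)]:\mathbf{El}_{s_3}(\mathbf{Prod}_{s_1,s_2}AB)$, $\mathbf{app}_{s_1,s_2}[A;B;M:\mathbf{El}_{s_3}(\mathbf{Prod}_{s_1,s_2}AB);N:\mathbf{El}_{s_1}A]:\mathbf{El}_{s_2}(BN)$ (with $A:\mathbf U_{s_1}$, $B:\mathbf{El}_{s_1}A\to\mathbf U_{s_2}$), and rule $\mathbf{app}_{s_1,s_2}AB(\mathbf{abs}_{s_1,s_2}A'B'M)N\hookrightarrow MN$. $\vdash_{DK}$ is typing in this theory. Translation: $[\![x]\!]=x$, $[\![s]\!]=\mathbf u_s$, $[\![\Pi_{s_1,s_2}(A,x.B)]\!]=\mathbf{Prod}_{s_1,s_2}[\![A]\!](\lambda x:\mathbf{El}_{s_1}[\![A]\!].[\![B]\!])$, $[\![\lambda_{s_1,s_2}(A,x.B,x.M)]\!]=\mathbf{abs}_{s_1,s_2}[\![A]\!](\lambda x:\mathbf{El}_{s_1}[\![A]\!].[\![B]\!])(\lambda x:\mathbf{El}_{s_1}[\![A]\!].[\![M]\!])$, $[\![@_{s_1,s_2}(A,x.B,M,N)]\!]=\mathbf{app}_{s_1,s_2}[\![A]\!](\lambda x:\mathbf{El}_{s_1}[\![A]\!].[\![B]\!])[\![M]\!][\![N]\!]$; $[\![\Gamma,x:A]\!]=[\![\Gamma]\!],x:\mathbf{El}_{s_A}[\![A]\!]$ where $\Gamma\vdash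 A:s_A$. Invertible forms: $M,N,A,B::=x\mid\mathbf u_s\mid\mathbf{abs}_{s_1,s_2}A(\lambda x:T_1.B)(\lambda x:T_2.M)\mid(\lambda x:T.M)N\mid\mathbf{Prod}_{s_1,s_2}A(\lambda x:T_1.B)\mid\mathbf{app}_{s_1,s_2}A(\lambda x:T_1.B)MN$, with $T,T_1,T_2$ arbitrary Dedukti terms. Inverse translation $\lfloor-\rfloor$ on invertible forms: $\lfloor x\rfloor=x$, $\lfloor\mathbf u_s\rfloor=s$, $\lfloor(\lambda x:T.M)N\rfloor=\lfloor M\rfloor\{\lfloor N\rfloor/x\}$, $\lfloor\mathbf{Prod}_{s_1,s_2}A(\lambda x:T.B)\rfloor=\Pi_{s_1,s_2}(\lfloor A\rfloor,x.\lfloor B\rfloor)$, $\lfloor\mathbf{abs}_{s_1,s_2}A(\lambda x:T.B)(\lambda x:T'.M)\rfloor=\lambda_{s_1,s_2}(\lfloor A\rfloor,x.\lfloor B\rfloor,x.\lfloor M\rfloor)$, $\lfloor\mathbf{app}_{s_1,s_2}A(\lambda x:T.B)MN\rfloor=@_{s_1,s_2}(\lfloor A\rfloor,x.\lfloor B\rfloor,\lfloor M\rfloor,\lfloor N\rfloor)$. A rewriting step is hidden if it is of the form $C(\lambda x:A.P)\hookrightarrow C(\lambda x:A'.P)$ with $A\hookrightarrow A'$ for a context $C$; $\equiv_H$ is the equivalence generated by hidden steps. *)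

(* Defs.v *)
From Stdlib Require Import List Relations.
Import ListNotations.
Set Implicit Arguments.

Record pts_spec : Type := PtsSpec {
  sort : Type;
  axiom_rel : sort -> sort -> Prop;
  rule_rel : sort -> sort -> sort -> Prop
}.

Definition functional_spec (P : pts_spec) : Prop :=
  (forall s t t' : sort P, axiom_rel P s t -> axiom_rel P s t' -> t = t') /\
  (forall s1 s2 t t' : sort P,
     rule_rel P s1 s2 t -> rule_rel P s1 s2 t' -> t = t').

(* Both calculi use de Bruijn indices: an argument written [x.B] (and the body
   of a lambda or product) is a term in which index 0 stands for [x], and the
   head of a context is its most recent declaration. *)

Definition up_ren (r : nat -> nat) (n : nat) : nat :=
  match n with 0 => 0 | S m => S (r m) end.

Section Encoding.

Variable P : pts_spec.
Local Notation sort := (sort P).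
Local Notation axiom_rel := (axiom_rel P).
Local Notation rule_rel := (rule_rel P).

Inductive term : Type :=
| Var (n : nat)
| Srt (s : sort)
| Pi (s1 s2 : sort) (A B : term)
| Lam (s1 s2 : sort) (A B M : term)
| App (s1 s2 : sort) (A B M N : term).

Fixpoint ren (r : nat -> nat) (t : term) : term :=
  match t with
  | Var n => Var (r n)
  | Srt s => Srt s
  | Pi s1 s2 A B => Pi s1 s2 (ren r A) (ren (up_ren r) B)
  | Lam s1 s2 A B M =>
      Lam s1 s2 (ren r A) (ren (up_ren r) B) (ren (up_ren r) M)
  | App s1 s2 A B M N =>
      App s1 s2 (ren r A) (ren (up_ren r) B) (ren r M) (ren r N)
  end.

Definition up (f : nat -> term) (n : nat) : term :=
  match n with 0 => Var 0 | S m => ren S (f m) end.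

Fixpoint subst (f : nat -> term) (t : term) : term :=
  match t with
  | Var n => f n
  | Srt s => Srt s
  | Pi s1 s2 A B => Pi s1 s2 (subst f A) (subst (up f) B)
  | Lam s1 s2 A B M =>
      Lam s1 s2 (subst f A) (subst (up f) B) (subst (up f) M)
  | App s1 s2 A B M N =>
      App s1 s2 (subst f A) (subst (up f) B) (subst f M) (subst f N)
  end.

(* [subst1 N M] is M{N/x}, where [x] is index 0 of [M]. *)
Definition subst1 (N M : term) : term :=
  subst (fun n => match n with 0 => N | S m => Var m end) M.

Inductive red : term -> term -> Prop :=
| red_beta s1 s2 s3 A B A' B' M N :
    rule_rel s1 s2 s3 ->
    red (App s1 s2 A B (Lam s1 s2 A' B' M) N) (subst1 N M)
| red_Pi1 s1 s2 A A' B : red A A' -> red (Pi s1 s2 A B) (Pi s1 s2 A' B)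
| red_Pi2 s1 s2 A B B' : red B B' -> red (Pi s1 s2 A B) (Pi s1 s2 A B')
| red_Lam1 s1 s2 A A' B M :
    red A A' -> red (Lam s1 s2 A B M) (Lam s1 s2 A' B M)
| red_Lam2 s1 s2 A B B' M :
    red B B' -> red (Lam s1 s2 A B M) (Lam s1 s2 A B' M)
| red_Lam3 s1 s2 A B M M' :
    red M M' -> red (Lam s1 s2 A B M) (Lam s1 s2 A B M')
| red_App1 s1 s2 A A' B M N :
    red A A' -> red (App s1 s2 A B M N) (App s1 s2 A' B M N)
| red_App2 s1 s2 A B B' M N :
    red B B' -> red (App s1 s2 A B M N) (App s1 s2 A B' M N)
| red_App3 s1 s2 A B M M' N :
    red M M' -> red (App s1 s2 A B M N) (App s1 s2 A B M' N)
| red_App4 s1 s2 A B M N N' :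
    red N N' -> red (App s1 s2 A B M N) (App s1 s2 A B M N').

Definition conv : term -> term -> Prop := clos_refl_sym_trans term red.

Definition ctx : Type := list term.

Inductive wf : ctx -> Prop :=
| wf_nil : wf []
| wf_cons G A s : typed G A (Srt s) -> wf (A :: G)
with typed : ctx -> term -> term -> Prop :=
| ty_conv G M A B s :
    typed G M A -> typed G B (Srt s) -> conv A B -> typed G M B
| ty_sort G s1 s2 : wf G -> axiom_rel s1 s2 -> typed G (Srt s1) (Srt s2)
| ty_var G n A :
    wf G -> nth_error G n = Some A -> typed G (Var n) (ren (Nat.add (S n)) A)
| ty_prod G s1 s2 s3 A B :
    rule_rel s1 s2 s3 ->
    typed G A (Srt s1) -> typed (A :: G) B (Srt s2) ->
    typed G (Pi s1 s2 A B) (Srt s3)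
| ty_abs G s1 s2 s3 A B M :
    rule_rel s1 s2 s3 ->
    typed G A (Srt s1) -> typed (A :: G) B (Srt s2) -> typed (A :: G) M B ->
    typed G (Lam s1 s2 A B M) (Pi s1 s2 A B)
| ty_app G s1 s2 s3 A B M N :
    rule_rel s1 s2 s3 ->
    typed G A (Srt s1) -> typed (A :: G) B (Srt s2) ->
    typed G N A -> typed G M (Pi s1 s2 A B) ->
    typed G (App s1 s2 A B M N) (subst1 N B).

(* The second case matters for top-sorts only: a well-formed context types
   every other sort. *)
Definition is_type (G : ctx) (A : term) : Prop :=
  (exists s, typed G A (Srt s)) \/ ((exists s, A = Srt s) /\ wf G).

Inductive dksort : Type := TYPE | KIND.

(* Dedukti terms over the signature of the encoding. Constants have a fixed
   arity and occur fully applied, so each of U_s, El_s, u_s, Prod_{s1,s2},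
   abs_{s1,s2}, app_{s1,s2} is a constructor taking that many arguments.
   The sorts indexing a raw constant are unconstrained: membership in the
   axioms and rules is required by the typing and rewrite rules. *)
Inductive dk : Type :=
| DVar (n : nat)
| DSrt (k : dksort)
| DPi (A B : dk)
| DLam (A M : dk)
| DApp (M N : dk)
| DU (s : sort)
| DEl (s : sort) (A : dk)
| Du (s : sort)
| DProd (s1 s2 : sort) (A B : dk)
| Dabs (s1 s2 : sort) (A B M : dk)
| Dapp (s1 s2 : sort) (A B M N : dk).

Fixpoint dren (r : nat -> nat) (t : dk) : dk :=
  match t with
  | DVar n => DVar (r n)
  | DSrt k => DSrt k
  | DPi A B => DPi (dren r A) (dren (up_ren r) B)
  | DLam A M => DLam (dren r A) (dren (up_ren r) M)
  | DApp M N => DApp (dren r M) (dren r N)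
  | DU s => DU s
  | DEl s A => DEl s (dren r A)
  | Du s => Du s
  | DProd s1 s2 A B => DProd s1 s2 (dren r A) (dren r B)
  | Dabs s1 s2 A B M => Dabs s1 s2 (dren r A) (dren r B) (dren r M)
  | Dapp s1 s2 A B M N =>
      Dapp s1 s2 (dren r A) (dren r B) (dren r M) (dren r N)
  end.

Definition dup (f : nat -> dk) (n : nat) : dk :=
  match n with 0 => DVar 0 | S m => dren S (f m) end.

Fixpoint dsubst (f : nat -> dk) (t : dk) : dk :=
  match t with
  | DVar n => f n
  | DSrt k => DSrt k
  | DPi A B => DPi (dsubst f A) (dsubst (dup f) B)
  | DLam A M => DLam (dsubst f A) (dsubst (dup f) M)
  | DApp M N => DApp (dsubst f M) (dsubst f N)
  | DU s => DU s
  | DEl s A => DEl s (dsubst f A)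
  | Du s => Du s
  | DProd s1 s2 A B => DProd s1 s2 (dsubst f A) (dsubst f B)
  | Dabs s1 s2 A B M => Dabs s1 s2 (dsubst f A) (dsubst f B) (dsubst f M)
  | Dapp s1 s2 A B M N =>
      Dapp s1 s2 (dsubst f A) (dsubst f B) (dsubst f M) (dsubst f N)
  end.

Definition dsubst1 (N M : dk) : dk :=
  dsubst (fun n => match n with 0 => N | S m => DVar m end) M.

Inductive ctx_closure (R : dk -> dk -> Prop) : dk -> dk -> Prop :=
| cc_root t u : R t u -> ctx_closure R t u
| cc_Pi1 A A' B : ctx_closure R A A' -> ctx_closure R (DPi A B) (DPi A' B)
| cc_Pi2 A B B' : ctx_closure R B B' -> ctx_closure R (DPi A B) (DPi A B')
| cc_Lam1 A A' M : ctx_closure R A A' -> ctx_closure R (DLam A M) (DLam A' M)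
| cc_Lam2 A M M' : ctx_closure R M M' -> ctx_closure R (DLam A M) (DLam A M')
| cc_App1 M M' N : ctx_closure R M M' -> ctx_closure R (DApp M N) (DApp M' N)
| cc_App2 M N N' : ctx_closure R N N' -> ctx_closure R (DApp M N) (DApp M N')
| cc_El s A A' : ctx_closure R A A' -> ctx_closure R (DEl s A) (DEl s A')
| cc_Prod1 s1 s2 A A' B :
    ctx_closure R A A' -> ctx_closure R (DProd s1 s2 A B) (DProd s1 s2 A' B)
| cc_Prod2 s1 s2 A B B' :
    ctx_closure R B B' -> ctx_closure R (DProd s1 s2 A B) (DProd s1 s2 A B')
| cc_abs1 s1 s2 A A' B M :
    ctx_closure R A A' -> ctx_closure R (Dabs s1 s2 A B M) (Dabs s1 s2 A' B M)
| cc_abs2 s1 s2 A B B' M :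
    ctx_closure R B B' -> ctx_closure R (Dabs s1 s2 A B M) (Dabs s1 s2 A B' M)
| cc_abs3 s1 s2 A B M M' :
    ctx_closure R M M' -> ctx_closure R (Dabs s1 s2 A B M) (Dabs s1 s2 A B M')
| cc_app1 s1 s2 A A' B M N :
    ctx_closure R A A' ->
    ctx_closure R (Dapp s1 s2 A B M N) (Dapp s1 s2 A' B M N)
| cc_app2 s1 s2 A B B' M N :
    ctx_closure R B B' ->
    ctx_closure R (Dapp s1 s2 A B M N) (Dapp s1 s2 A B' M N)
| cc_app3 s1 s2 A B M M' N :
    ctx_closure R M M' ->
    ctx_closure R (Dapp s1 s2 A B M N) (Dapp s1 s2 A B M' N)
| cc_app4 s1 s2 A B M N N' :
    ctx_closure R N N' ->
    ctx_closure R (Dapp s1 s2 A B M N) (Dapp s1 s2 A B M N').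

Inductive beta_root : dk -> dk -> Prop :=
| beta_root_intro A M N : beta_root (DApp (DLam A M) N) (dsubst1 N M).

Inductive rewrite_root : dk -> dk -> Prop :=
| rw_El s1 s2 : axiom_rel s1 s2 -> rewrite_root (DEl s2 (Du s1)) (DU s1)
| rw_app s1 s2 s3 A B A' B' M N :
    rule_rel s1 s2 s3 ->
    rewrite_root (Dapp s1 s2 A B (Dabs s1 s2 A' B' M) N) (DApp M N).

Definition dk_beta : dk -> dk -> Prop := ctx_closure beta_root.

Definition dk_red : dk -> dk -> Prop :=
  ctx_closure (fun t u => beta_root t u \/ rewrite_root t u).

Definition dk_conv : dk -> dk -> Prop := clos_refl_sym_trans dk dk_red.

Inductive hidden_root : dk -> dk -> Prop :=
| hidden_root_intro A A' M :
    dk_red A A' -> hidden_root (DLam A M) (DLam A' M).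

Definition hidden_step : dk -> dk -> Prop := ctx_closure hidden_root.

Definition hidden_conv : dk -> dk -> Prop := clos_refl_sym_trans dk hidden_step.

Definition dkctx : Type := list dk.

(* The rules from [dty_U] on are the instances, one per constant c[Delta] : A
   of the signature, of the constant rule: G |- args : Delta gives
   G |- c args : A{args}. *)
Inductive dwf : dkctx -> Prop :=
| dwf_nil : dwf []
| dwf_cons G A : dtyped G A (DSrt TYPE) -> dwf (A :: G)
with dtyped : dkctx -> dk -> dk -> Prop :=
| dty_conv G M A B k :
    dtyped G M A -> dtyped G B (DSrt k) -> dk_conv A B -> dtyped G M B
| dty_sort G : dwf G -> dtyped G (DSrt TYPE) (DSrt KIND)
| dty_var G n A :
    dwf G -> nth_error G n = Some A ->
    dtyped G (DVar n) (dren (Nat.add (S n)) A)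
| dty_prod G A B k :
    dtyped G A (DSrt TYPE) -> dtyped (A :: G) B (DSrt k) ->
    dtyped G (DPi A B) (DSrt k)
| dty_abs G A B M k :
    dtyped G A (DSrt TYPE) -> dtyped (A :: G) B (DSrt k) ->
    dtyped (A :: G) M B ->
    dtyped G (DLam A M) (DPi A B)
| dty_app G A B M N :
    dtyped G M (DPi A B) -> dtyped G N A ->
    dtyped G (DApp M N) (dsubst1 N B)
| dty_U G s : dwf G -> dtyped G (DU s) (DSrt TYPE)
| dty_El G s A : dtyped G A (DU s) -> dtyped G (DEl s A) (DSrt TYPE)
| dty_u G s1 s2 : axiom_rel s1 s2 -> dwf G -> dtyped G (Du s1) (DU s2)
| dty_Prod G s1 s2 s3 A B :
    rule_rel s1 s2 s3 ->
    dtyped G A (DU s1) -> dtyped G B (DPi (DEl s1 A) (DU s2)) ->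
    dtyped G (DProd s1 s2 A B) (DU s3)
| dty_cabs G s1 s2 s3 A B M :
    rule_rel s1 s2 s3 ->
    dtyped G A (DU s1) -> dtyped G B (DPi (DEl s1 A) (DU s2)) ->
    dtyped G M (DPi (DEl s1 A) (DEl s2 (DApp (dren S B) (DVar 0)))) ->
    dtyped G (Dabs s1 s2 A B M) (DEl s3 (DProd s1 s2 A B))
| dty_capp G s1 s2 s3 A B M N :
    rule_rel s1 s2 s3 ->
    dtyped G A (DU s1) -> dtyped G B (DPi (DEl s1 A) (DU s2)) ->
    dtyped G M (DEl s3 (DProd s1 s2 A B)) -> dtyped G N (DEl s1 A) ->
    dtyped G (Dapp s1 s2 A B M N) (DEl s2 (DApp B N)).

Fixpoint tr (t : term) : dk :=
  match t with
  | Var n => DVar n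
  | Srt s => Du s
  | Pi s1 s2 A B => DProd s1 s2 (tr A) (DLam (DEl s1 (tr A)) (tr B))
  | Lam s1 s2 A B M =>
      Dabs s1 s2 (tr A) (DLam (DEl s1 (tr A)) (tr B))
                        (DLam (DEl s1 (tr A)) (tr M))
  | App s1 s2 A B M N =>
      Dapp s1 s2 (tr A) (DLam (DEl s1 (tr A)) (tr B)) (tr M) (tr N)
  end.

(* A relation because the sort s_A is read off a typing derivation; for a
   functional specification it is unique. *)
Inductive tr_ctx : ctx -> dkctx -> Prop :=
| tr_ctx_nil : tr_ctx [] []
| tr_ctx_cons G D A s :
    tr_ctx G D -> typed G A (Srt s) -> tr_ctx (A :: G) (DEl s (tr A) :: D).

Inductive invertible : dk -> Prop :=
| inv_Var n : invertible (DVar n)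
| inv_u s : invertible (Du s)
| inv_abs s1 s2 A T1 B T2 M :
    invertible A -> invertible B -> invertible M ->
    invertible (Dabs s1 s2 A (DLam T1 B) (DLam T2 M))
| inv_beta T M N :
    invertible M -> invertible N -> invertible (DApp (DLam T M) N)
| inv_Prod s1 s2 A T1 B :
    invertible A -> invertible B -> invertible (DProd s1 s2 A (DLam T1 B))
| inv_app s1 s2 A T1 B M N :
    invertible A -> invertible B -> invertible M -> invertible N ->
    invertible (Dapp s1 s2 A (DLam T1 B) M N).

(* Only meaningful on invertible forms; the last case is a dummy value. *)
Fixpoint untr (t : dk) : term :=
  match t with
  | DVar n => Var n
  | Du s => Srt s
  | DApp (DLam _ M) N => subst1 (untr N) (untr M)
  | DProd s1 s2 A (DLam _ B) => Pi s1 s2 (untr A) (untr B)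
  | Dabs s1 s2 A (DLam _ B) (DLam _ M) =>
      Lam s1 s2 (untr A) (untr B) (untr M)
  | Dapp s1 s2 A (DLam _ B) M N =>
      App s1 s2 (untr A) (untr B) (untr M) (untr N)
  | _ => Var 0
  end.

Definition beta_nf_of (M N : dk) : Prop :=
  clos_refl_trans dk dk_beta M N /\ ~ (exists N', dk_beta N N').

End Encoding.

(* Main.v *)
(** Erasing dependencies turns every Dedukti term over this signature into a
    simply typed term, so beta terminates on typed terms; beta and the full
    rewrite relation are orthogonal, hence confluent.  A beta-normal object in a
    translated context can only have a function type by being an abstraction,
    since every variable has type [El_s _], which is not convertible to a
    product.  Induction on the normal form then shows that it is invertible and
    that its inverse is typable: a type conversion met on the way relates two
    translations, and it is reflected in the EPTS because every reduct of a
    translation is invertible and the inverse translation maps reduction steps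
    to conversions.  The abstraction annotations are the only places where the
    normal form and the translation of its inverse differ. *)

Require Import Defs.
From Stdlib Require Import List Relations Classical Lia.
Import ListNotations.

(** A PTS specification need not normalize, but this does not reach beta: [Dabs] and [Dapp] are
    inert constants for beta, and a divergence of the EPTS is simulated only with the help of the
    rewrite rule for [app]. The erasure survives conversion of types because [El] and [U] both go to
    the base type, so collapsing one into the other is invisible.

    The obstacle in the final induction is the annotation of a binder. In a normal form it is an
    arbitrary term, whereas the induction speaks of contexts that are translations. The domain is
    therefore inverted before the body, and the annotation is exchanged for the translation of that
    inverse. Doing this inside Dedukti typing would require the new annotation to be typable, that
    is, soundness of the translation. The judgment [oty] removes the difficulty: it types objects
    only, and its conversion rule asks nothing of the types involved. *)

Section Conservativity.

Variable P : pts_spec.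
Local Notation term := (term P).
Local Notation dk := (dk P).
Local Notation sort := (sort P).

Arguments Var {P} n.
Arguments Srt {P} s.
Arguments DVar {P} n.
Arguments DSrt {P} k.
Arguments DU {P} s.
Arguments Du {P} s.

(** * Substitution algebra *)

Lemma dren_ext (t : dk) : forall r r', (forall n, r n = r' n) -> dren r t = dren r' t.
Proof.
  induction t; simpl; intros r r' H; f_equal; auto;
    match goal with IH : _ |- dren (up_ren _) _ = _ => apply IH end;
    intros [|m]; simpl; congruence.
Qed.

Lemma dsubst_ext (t : dk) : forall f g, (forall n, f n = g n) -> dsubst f t = dsubst g t.
Proof.
  induction t; simpl; intros f g H; f_equal; auto;
    match goal with IH : _ |- dsubst (dup _) _ = _ => apply IH end;
    intros [|m]; simpl; congruence.
Qed.

Lemma dren_dren (t : dk) : forall r r', dren r (dren r' t) = dren (fun n => r (r' n)) t.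
Proof.
  induction t; simpl; intros r r'; f_equal; auto;
    match goal with IH : _ |- dren (up_ren _) _ = _ => rewrite IH; apply dren_ext end;
    intros [|m]; simpl; congruence.
Qed.

Lemma dsubst_dren (t : dk) : forall f r, dsubst f (dren r t) = dsubst (fun n => f (r n)) t.
Proof.
  induction t; simpl; intros f r; f_equal; auto;
    match goal with IH : _ |- dsubst (dup _) _ = _ => rewrite IH; apply dsubst_ext end;
    intros [|m]; simpl; congruence.
Qed.

Lemma dren_dsubst (t : dk) : forall r f, dren r (dsubst f t) = dsubst (fun n => dren r (f n)) t.
Proof.
  induction t; simpl; intros r f; f_equal; auto;
    match goal with IH : _ |- dren (up_ren _) _ = _ => rewrite IH; apply dsubst_ext end;
    intros [|m]; simpl; auto; rewrite !dren_dren; reflexivity.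
Qed.

Lemma dsubst_dsubst (t : dk) :
  forall f g, dsubst f (dsubst g t) = dsubst (fun n => dsubst f (g n)) t.
Proof.
  induction t; simpl; intros f g; f_equal; auto;
    match goal with IH : _ |- dsubst (dup _) _ = _ => rewrite IH; apply dsubst_ext end;
    intros [|m]; simpl; auto; rewrite dsubst_dren, dren_dsubst; reflexivity.
Qed.

Lemma dsubst_id (t : dk) : forall f, (forall n, f n = DVar n) -> dsubst f t = t.
Proof.
  induction t; simpl; intros f H; f_equal; auto;
    match goal with IH : _ |- dsubst (dup _) _ = _ => apply IH end;
    intros [|m]; simpl; auto; rewrite H; reflexivity.
Qed.

Lemma dren_as_dsubst (t : dk) r : dren r t = dsubst (fun n => DVar (r n)) t.
Proof.
  rewrite <- (dsubst_id (dren r t) DVar) by auto. now rewrite dsubst_dren.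
Qed.

Definition dcons (N : dk) (f : nat -> dk) (n : nat) : dk :=
  match n with 0 => N | S m => f m end.

Lemma dsubst1_dup (N M : dk) f : dsubst1 N (dsubst (dup f) M) = dsubst (dcons N f) M.
Proof.
  unfold dsubst1. rewrite dsubst_dsubst. apply dsubst_ext. intros [|m]; simpl; auto.
  rewrite dsubst_dren. now apply dsubst_id.
Qed.

Lemma dsubst_dsubst1 (N M : dk) f :
  dsubst f (dsubst1 N M) = dsubst1 (dsubst f N) (dsubst (dup f) M).
Proof.
  rewrite dsubst1_dup. unfold dsubst1. rewrite dsubst_dsubst.
  apply dsubst_ext. now intros [|m].
Qed.

Lemma dren_dsubst1 (N M : dk) r :
  dren r (dsubst1 N M) = dsubst1 (dren r N) (dren (up_ren r) M).
Proof.
  unfold dsubst1. rewrite dren_dsubst, dsubst_dren. apply dsubst_ext. now intros [|m].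
Qed.

Lemma dren_up_S (M : dk) r : dren (up_ren r) (dren S M) = dren S (dren r M).
Proof. now rewrite !dren_dren. Qed.

Lemma dsubst_dup_S (M : dk) f : dsubst (dup f) (dren S M) = dren S (dsubst f M).
Proof. now rewrite dsubst_dren, dren_dsubst. Qed.

(** * The same algebra for EPTS terms *)

Lemma ren_ext (t : term) : forall r r', (forall n, r n = r' n) -> ren r t = ren r' t.
Proof.
  induction t; simpl; intros r r' H; f_equal; auto;
    match goal with IH : _ |- ren (up_ren _) ?t = _ => apply (IH : forall r r', _ -> ren r t = _) end;
    intros [|m]; simpl; congruence.
Qed.

Lemma subst_ext (t : term) : forall f g, (forall n, f n = g n) -> subst f t = subst g t.
Proof.
  induction t; simpl; intros f g H; f_equal; auto;
    match goal with IH : _ |- subst (up _) ?t = _ => apply (IH : forall r r', _ -> subst r t = _) end;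
    intros [|m]; simpl; congruence.
Qed.

Lemma ren_ren (t : term) : forall r r', ren r (ren r' t) = ren (fun n => r (r' n)) t.
Proof.
  induction t; simpl; intros r r'; f_equal; auto;
    match goal with IH : forall r r', ren r (ren r' ?t) = _ |- ren (up_ren _) (ren _ ?t) = _ =>
      rewrite IH; apply ren_ext end;
    intros [|m]; simpl; congruence.
Qed.

Lemma subst_ren (t : term) : forall f r, subst f (ren r t) = subst (fun n => f (r n)) t.
Proof.
  induction t; simpl; intros f r; f_equal; auto;
    match goal with IH : forall f r, subst f (ren r ?t) = _ |- subst _ (ren _ ?t) = _ =>
      rewrite IH; apply subst_ext end;
    intros [|m]; simpl; congruence.
Qed.

Lemma ren_subst (t : term) : forall r f, ren r (subst f t) = subst (fun n => ren r (f n)) t.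
Proof.
  induction t; simpl; intros r f; f_equal; auto;
    match goal with IH : forall r f, ren r (subst f ?t) = _ |- ren _ (subst _ ?t) = _ =>
      rewrite IH; apply subst_ext end;
    intros [|m]; simpl; auto; rewrite !ren_ren; reflexivity.
Qed.

Lemma subst_subst (t : term) :
  forall f g, subst f (subst g t) = subst (fun n => subst f (g n)) t.
Proof.
  induction t; simpl; intros f g; f_equal; auto;
    match goal with IH : forall f g, subst f (subst g ?t) = _ |- subst _ (subst _ ?t) = _ =>
      rewrite IH; apply subst_ext end;
    intros [|m]; simpl; auto; rewrite subst_ren, ren_subst; reflexivity.
Qed.

Lemma subst_id (t : term) : forall f, (forall n, f n = Var n) -> subst f t = t.
Proof.
  induction t; simpl; intros f H; f_equal; auto;
    match goal with IH : forall f, _ -> subst f ?t = _ |- subst (up _) ?t = _ => apply IH end;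
    intros [|m]; simpl; auto; rewrite H; reflexivity.
Qed.

Lemma subst_subst1 (N M : term) f :
  subst f (subst1 N M) = subst1 (subst f N) (subst (up f) M).
Proof.
  unfold subst1. rewrite !subst_subst. apply subst_ext. intros [|m]; simpl; auto.
  rewrite subst_ren. symmetry. now apply subst_id.
Qed.

Lemma ren_subst1 (N M : term) r :
  ren r (subst1 N M) = subst1 (ren r N) (ren (up_ren r) M).
Proof.
  unfold subst1. rewrite ren_subst, subst_ren. apply subst_ext. now intros [|m].
Qed.

(** * Confluence *)

Section Closure.

Variable R : dk -> dk -> Prop.

(** Generic in the root relation because [dk_red], [dk_beta] and [hidden_step] are all contextual
    closures: [dk_conv] and [hidden_conv] unfold to instances of [cconv], and one set of congruence
    lemmas serves both. *)
Definition reds : dk -> dk -> Prop := clos_refl_trans dk (ctx_closure R).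
Definition cconv : dk -> dk -> Prop := clos_refl_sym_trans dk (ctx_closure R).

Lemma reds_map (F : dk -> dk) :
  (forall x y, ctx_closure R x y -> ctx_closure R (F x) (F y)) ->
  forall x y, reds x y -> reds (F x) (F y).
Proof.
  intros HF x y H. induction H.
  - apply rt_step; auto.
  - apply rt_refl.
  - eapply rt_trans; eauto.
Qed.

Lemma cconv_map (F : dk -> dk) :
  (forall x y, ctx_closure R x y -> ctx_closure R (F x) (F y)) ->
  forall x y, cconv x y -> cconv (F x) (F y).
Proof.
  intros HF x y H. induction H.
  - apply rst_step; auto.
  - apply rst_refl.
  - apply rst_sym; auto.
  - eapply rst_trans; eauto.
Qed.

Lemma reds_cconv x y : reds x y -> cconv x y.
Proof.
  induction 1; [apply rst_step | apply rst_refl | eapply rst_trans]; eauto.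
Qed.

Lemma reds_Pi A A' B B' : reds A A' -> reds B B' -> reds (DPi A B) (DPi A' B').
Proof.
  intros; apply rt_trans with (DPi A' B);
    [apply (reds_map (fun x => DPi x B)) | apply reds_map]; auto using ctx_closure.
Qed.

Lemma reds_Lam A A' B B' : reds A A' -> reds B B' -> reds (DLam A B) (DLam A' B').
Proof.
  intros; apply rt_trans with (DLam A' B);
    [apply (reds_map (fun x => DLam x B)) | apply reds_map]; auto using ctx_closure.
Qed.

Lemma reds_App A A' B B' : reds A A' -> reds B B' -> reds (DApp A B) (DApp A' B').
Proof.
  intros; apply rt_trans with (DApp A' B);
    [apply (reds_map (fun x => DApp x B)) | apply reds_map]; auto using ctx_closure.
Qed.

Lemma reds_El s A A' : reds A A' -> reds (DEl s A) (DEl s A').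
Proof. intros; apply reds_map; auto using ctx_closure. Qed.

Lemma reds_Prod s1 s2 A A' B B' :
  reds A A' -> reds B B' -> reds (DProd s1 s2 A B) (DProd s1 s2 A' B').
Proof.
  intros; apply rt_trans with (DProd s1 s2 A' B);
    [apply (reds_map (fun x => DProd s1 s2 x B)) | apply reds_map]; auto using ctx_closure.
Qed.

Lemma reds_abs s1 s2 A A' B B' M M' :
  reds A A' -> reds B B' -> reds M M' -> reds (Dabs s1 s2 A B M) (Dabs s1 s2 A' B' M').
Proof.
  intros; apply rt_trans with (Dabs s1 s2 A' B M);
    [apply (reds_map (fun x => Dabs s1 s2 x B M)); auto using ctx_closure |].
  apply rt_trans with (Dabs s1 s2 A' B' M);
    [apply (reds_map (fun x => Dabs s1 s2 A' x M)) | apply reds_map]; auto using ctx_closure.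
Qed.

Lemma reds_app s1 s2 A A' B B' M M' N N' :
  reds A A' -> reds B B' -> reds M M' -> reds N N' ->
  reds (Dapp s1 s2 A B M N) (Dapp s1 s2 A' B' M' N').
Proof.
  intros; apply rt_trans with (Dapp s1 s2 A' B M N);
    [apply (reds_map (fun x => Dapp s1 s2 x B M N)); auto using ctx_closure |].
  apply rt_trans with (Dapp s1 s2 A' B' M N);
    [apply (reds_map (fun x => Dapp s1 s2 A' x M N)); auto using ctx_closure |].
  apply rt_trans with (Dapp s1 s2 A' B' M' N);
    [apply (reds_map (fun x => Dapp s1 s2 A' B' x N)) | apply reds_map];
    auto using ctx_closure.
Qed.

Lemma cconv_Pi A A' B B' : cconv A A' -> cconv B B' -> cconv (DPi A B) (DPi A' B').
Proof.
  intros; apply rst_trans with (DPi A' B);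
    [apply (cconv_map (fun x => DPi x B)) | apply cconv_map]; auto using ctx_closure.
Qed.

Lemma cconv_Lam A A' B B' : cconv A A' -> cconv B B' -> cconv (DLam A B) (DLam A' B').
Proof.
  intros; apply rst_trans with (DLam A' B);
    [apply (cconv_map (fun x => DLam x B)) | apply cconv_map]; auto using ctx_closure.
Qed.

Lemma cconv_App A A' B B' : cconv A A' -> cconv B B' -> cconv (DApp A B) (DApp A' B').
Proof.
  intros; apply rst_trans with (DApp A' B);
    [apply (cconv_map (fun x => DApp x B)) | apply cconv_map]; auto using ctx_closure.
Qed.

Lemma cconv_El s A A' : cconv A A' -> cconv (DEl s A) (DEl s A').
Proof. intros; apply cconv_map; auto using ctx_closure. Qed.

Lemma cconv_Prod s1 s2 A A' B B' :
  cconv A A' -> cconv B B' -> cconv (DProd s1 s2 A B) (DProd s1 s2 A' B').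
Proof.
  intros; apply rst_trans with (DProd s1 s2 A' B);
    [apply (cconv_map (fun x => DProd s1 s2 x B)) | apply cconv_map]; auto using ctx_closure.
Qed.

Lemma cconv_abs s1 s2 A A' B B' M M' :
  cconv A A' -> cconv B B' -> cconv M M' ->
  cconv (Dabs s1 s2 A B M) (Dabs s1 s2 A' B' M').
Proof.
  intros; apply rst_trans with (Dabs s1 s2 A' B M);
    [apply (cconv_map (fun x => Dabs s1 s2 x B M)); auto using ctx_closure |].
  apply rst_trans with (Dabs s1 s2 A' B' M);
    [apply (cconv_map (fun x => Dabs s1 s2 A' x M)) | apply cconv_map]; auto using ctx_closure.
Qed.

Lemma cconv_app s1 s2 A A' B B' M M' N N' :
  cconv A A' -> cconv B B' -> cconv M M' -> cconv N N' ->
  cconv (Dapp s1 s2 A B M N) (Dapp s1 s2 A' B' M' N').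
Proof.
  intros; apply rst_trans with (Dapp s1 s2 A' B M N);
    [apply (cconv_map (fun x => Dapp s1 s2 x B M N)); auto using ctx_closure |].
  apply rst_trans with (Dapp s1 s2 A' B' M N);
    [apply (cconv_map (fun x => Dapp s1 s2 A' x M N)); auto using ctx_closure |].
  apply rst_trans with (Dapp s1 s2 A' B' M' N);
    [apply (cconv_map (fun x => Dapp s1 s2 A' B' x N)) | apply cconv_map];
    auto using ctx_closure.
Qed.

End Closure.

(* The proposition [Q] switches the two rewrite rules on or off, so that the
   same diamond property yields confluence of both [dk_red] and [dk_beta]. *)
Inductive par (Q : Prop) : dk -> dk -> Prop :=
| par_Var n : par Q (DVar n) (DVar n)
| par_Srt k : par Q (DSrt k) (DSrt k)
| par_Pi A A' B B' : par Q A A' -> par Q B B' -> par Q (DPi A B) (DPi A' B')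
| par_Lam A A' M M' : par Q A A' -> par Q M M' -> par Q (DLam A M) (DLam A' M')
| par_App M M' N N' : par Q M M' -> par Q N N' -> par Q (DApp M N) (DApp M' N')
| par_U s : par Q (DU s) (DU s)
| par_El s A A' : par Q A A' -> par Q (DEl s A) (DEl s A')
| par_u s : par Q (Du s) (Du s)
| par_Prod s1 s2 A A' B B' :
    par Q A A' -> par Q B B' -> par Q (DProd s1 s2 A B) (DProd s1 s2 A' B')
| par_abs s1 s2 A A' B B' M M' :
    par Q A A' -> par Q B B' -> par Q M M' ->
    par Q (Dabs s1 s2 A B M) (Dabs s1 s2 A' B' M')
| par_app s1 s2 A A' B B' M M' N N' :
    par Q A A' -> par Q B B' -> par Q M M' -> par Q N N' ->
    par Q (Dapp s1 s2 A B M N) (Dapp s1 s2 A' B' M' N')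
| par_beta A M M' N N' :
    par Q M M' -> par Q N N' -> par Q (DApp (DLam A M) N) (dsubst1 N' M')
| par_rw_El s1 s2 : Q -> axiom_rel P s1 s2 -> par Q (DEl s2 (Du s1)) (DU s1)
| par_rw_app s1 s2 s3 A B A' B' M M' N N' :
    Q -> rule_rel P s1 s2 s3 -> par Q M M' -> par Q N N' ->
    par Q (Dapp s1 s2 A B (Dabs s1 s2 A' B' M) N) (DApp M' N').

#[local] Hint Constructors par : core.

Section ChurchRosser.

Variable Q : Prop.

Lemma par_refl t : par Q t t.
Proof. induction t; eauto. Qed.

Lemma par_dren t u : par Q t u -> forall r, par Q (dren r t) (dren r u).
Proof.
  induction 1; simpl; intros r; eauto.
  rewrite dren_dsubst1. now apply par_beta.
Qed.

Lemma par_dup f g : (forall n, par Q (f n) (g n)) -> forall n, par Q (dup f n) (dup g n).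
Proof. intros H [|m]; simpl; [apply par_Var | apply par_dren, H]. Qed.

Lemma par_dsubst t u : par Q t u ->
  forall f g, (forall n, par Q (f n) (g n)) -> par Q (dsubst f t) (dsubst g u).
Proof.
  induction 1; simpl; intros f g Hfg; eauto using par_dup.
  - apply par_app; eauto.
  - rewrite dsubst_dsubst1. apply par_beta; auto using par_dup.
Qed.

Lemma par_dsubst1 M M' N N' : par Q M M' -> par Q N N' -> par Q (dsubst1 N M) (dsubst1 N' M').
Proof. intros HM HN. apply par_dsubst; auto. intros [|m]; simpl; auto. Qed.

Ltac join :=
  repeat match goal with
  | IH : forall u, par Q ?x u -> exists v, _, H : par Q ?x _ |- _ =>
      destruct (IH _ H) as (? & ? & ?); clear IH
  end.

(** The subterms inside a redex pattern are headed by [DLam], [Dabs] or [Du], and [par] never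
    changes these heads. A redex thus survives any parallel step made inside it, and contracting it
    afterwards closes the fork. *)
Lemma par_diamond t u : par Q t u ->
  forall v, par Q t v -> exists w, par Q u w /\ par Q v w.
Proof.
  induction 1; intros v Hv; inversion Hv; subst;
    try solve [join; eexists; split; eauto using par_dsubst1].
  - inversion H; subst.
    (* Contraction forgets the annotation, so the hypothesis for the abstraction is used with [A]
       left unreduced; inverting both outcomes gives a common reduct of the bodies. The case of
       [Dabs] below proceeds in the same way. *)
    destruct (IHpar1 (DLam A M'0)) as (w & Hw1 & Hw2); [auto using par_refl|].
    inversion Hw1; subst. inversion Hw2; subst. join.
    eexists; split; [apply par_beta | apply par_dsubst1]; eauto.
  - inversion H; subst. eexists; split; [apply par_rw_El | apply par_U]; auto.
  - inversion H1; subst.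
    destruct (IHpar3 (Dabs s1 s2 A'0 B'0 M'0)) as (w & Hw1 & Hw2); [auto using par_refl|].
    inversion Hw1; subst. inversion Hw2; subst. join.
    eexists; split; [eapply par_rw_app | apply par_App]; eauto.
  - inversion H3; subst. join.
    eexists; split; [apply par_dsubst1 | apply par_beta]; eauto.
  - match goal with H : par Q (Du _) _ |- _ => inversion H; subst end.
    eexists; split; [apply par_U | apply par_rw_El]; auto.
  - match goal with H : par Q (Dabs _ _ _ _ _) _ |- _ => inversion H; subst end. join.
    eexists; split; [apply par_App | eapply par_rw_app]; eauto.
Qed.

Lemma par_strip t u : clos_refl_trans dk (par Q) t u ->
  forall v, par Q t v -> exists w, par Q u w /\ clos_refl_trans dk (par Q) v w.
Proof.
  induction 1 as [t u H | t | t u u' _ IH1 _ IH2]; intros v Hv.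
  - destruct (par_diamond _ _ H _ Hv) as (w & ? & ?). eauto using rt_step.
  - eauto using rt_refl.
  - destruct (IH1 _ Hv) as (w & Hw & ?). destruct (IH2 _ Hw) as (w' & ? & ?).
    eauto using rt_trans.
Qed.

Lemma par_confluent t u : clos_refl_trans dk (par Q) t u ->
  forall v, clos_refl_trans dk (par Q) t v ->
  exists w, clos_refl_trans dk (par Q) u w /\ clos_refl_trans dk (par Q) v w.
Proof.
  intros Hu v Hv. revert u Hu.
  induction Hv as [t v H | t | t v v' _ IH1 _ IH2]; intros u Hu.
  - destruct (par_strip _ _ Hu _ H) as (w & ? & ?). eauto using rt_step.
  - eauto using rt_refl.
  - destruct (IH1 _ Hu) as (w & ? & Hw). destruct (IH2 _ Hw) as (w' & ? & ?).
    eauto using rt_trans.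
Qed.

Variable R : dk -> dk -> Prop.
Hypothesis HR : forall t u, R t u <-> beta_root t u \/ (Q /\ rewrite_root t u).

Lemma step_par t u : ctx_closure R t u -> par Q t u.
Proof.
  induction 1; eauto using par_refl.
  apply HR in H as [H | [HQ H]]; destruct H; eauto using par_refl.
Qed.

Lemma par_reds t u : par Q t u -> reds R t u.
Proof.
  induction 1; try apply rt_refl;
    auto using reds_Pi, reds_Lam, reds_App, reds_El, reds_Prod, reds_abs, reds_app.
  - apply rt_trans with (DApp (DLam A M') N');
      [apply reds_App; auto; apply reds_Lam; auto; apply rt_refl |].
    apply rt_step, cc_root, HR. left. constructor.
  - apply rt_step, cc_root, HR. right. split; auto. now constructor.
  - apply rt_trans with (Dapp s1 s2 A B (Dabs s1 s2 A' B' M') N').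
    + apply reds_app; try apply rt_refl; auto. apply reds_abs; auto; apply rt_refl.
    + apply rt_step, cc_root, HR. right. split; auto. econstructor; eauto.
Qed.

Lemma reds_pars t u : reds R t u <-> clos_refl_trans dk (par Q) t u.
Proof.
  split.
  - induction 1; eauto using rt_refl, rt_trans, rt_step, step_par.
  - induction 1; eauto using par_reds; [apply rt_refl | eapply rt_trans; eauto].
Qed.

Lemma church_rosser t u : cconv R t u -> exists v, reds R t v /\ reds R u v.
Proof.
  induction 1 as [t u H | t | t u _ IH | t u v _ IH1 _ IH2].
  - exists u. split; [now apply rt_step | apply rt_refl].
  - exists t. split; apply rt_refl.
  - destruct IH as (v & ? & ?); eauto.
  - destruct IH1 as (w1 & H1 & H1'). destruct IH2 as (w2 & H2 & H2').
    apply reds_pars in H1', H2. destruct (par_confluent _ _ H1' _ H2) as (w & Ha & Hb).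
    apply reds_pars in Ha, Hb. exists w. split; eapply rt_trans; eauto.
Qed.

End ChurchRosser.

Definition dk_root (t u : dk) : Prop := beta_root t u \/ rewrite_root t u.

Lemma dk_church_rosser (t u : dk) :
  dk_conv t u -> exists v, reds dk_root t v /\ reds dk_root u v.
Proof. apply (church_rosser True). unfold dk_root. tauto. Qed.

Lemma beta_church_rosser (t u : dk) :
  cconv (@beta_root P) t u -> exists v, reds (@beta_root P) t v /\ reds (@beta_root P) u v.
Proof. apply (church_rosser False). tauto. Qed.

Lemma dk_conv_refl (t : dk) : dk_conv t t.
Proof. apply rst_refl. Qed.

Lemma dk_conv_sym (t u : dk) : dk_conv t u -> dk_conv u t.
Proof. apply rst_sym. Qed.

Lemma dk_conv_trans (t u v : dk) : dk_conv t u -> dk_conv u v -> dk_conv t v.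
Proof. apply rst_trans. Qed.

Lemma reds_dk_conv (t u : dk) : reds dk_root t u -> dk_conv t u.
Proof. apply reds_cconv. Qed.

(** * Injectivity and disjointness of the type formers *)

Lemma reds_from_Pi (A B u : dk) : reds dk_root (DPi A B) u ->
  exists A' B', u = DPi A' B' /\ reds dk_root A A' /\ reds dk_root B B'.
Proof.
  intros H. apply clos_rt_rtn1 in H. induction H as [|u v Hs _ (A' & B' & -> & HA & HB)].
  - exists A, B. repeat split; apply rt_refl.
  - inversion Hs as [? ? [Hr|Hr]| | | | | | | | | | | | | | | |]; subst;
      [inversion Hr | inversion Hr | |]; repeat eexists; eauto;
      eapply rt_trans; eauto; now apply rt_step.
Qed.

Lemma reds_from_U s (u : dk) : reds dk_root (DU s) u -> u = DU s.
Proof.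
  intros H. apply clos_rt_rtn1 in H. induction H as [|u v Hs _ ->]; auto.
  inversion Hs as [? ? [Hr|Hr]| | | | | | | | | | | | | | | |]; subst; inversion Hr.
Qed.

(** [DEl] is the one type former that can lose its head, namely when its argument reaches a code
    [Du s0]; from [DU s0] no further step exists. *)
Lemma reds_from_El s (A u : dk) : reds dk_root (DEl s A) u ->
  (exists A', u = DEl s A' /\ reds dk_root A A') \/
  (exists s0, u = DU s0 /\ axiom_rel P s0 s /\ reds dk_root A (Du s0)).
Proof.
  intros H. apply clos_rt_rtn1 in H.
  induction H as [|u v Hs _ [(A' & -> & HA) | (s0 & -> & Hax & HA)]].
  - left. exists A. split; auto. apply rt_refl.
  - inversion Hs as [? ? [Hr|Hr]| | | | | | | | | | | | | | | |]; subst;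
      [inversion Hr | inversion Hr; subst; right; eauto |].
    left. eexists; split; eauto. eapply rt_trans; eauto; now apply rt_step.
  - apply rt_step, reds_from_U in Hs. subst. right. eauto.
Qed.

Lemma Pi_inj (A B A' B' : dk) :
  dk_conv (DPi A B) (DPi A' B') -> dk_conv A A' /\ dk_conv B B'.
Proof.
  intros H. apply dk_church_rosser in H as (v & H1 & H2).
  apply reds_from_Pi in H1 as (A1 & B1 & -> & HA1 & HB1).
  apply reds_from_Pi in H2 as (A2 & B2 & E & HA2 & HB2). injection E as <- <-.
  split; eapply dk_conv_trans; eauto using reds_dk_conv, dk_conv_sym.
Qed.

Lemma U_inj s s' : dk_conv (DU s : dk) (DU s') -> s = s'.
Proof.
  intros H. apply dk_church_rosser in H as (v & H1 & H2).
  apply reds_from_U in H1, H2. congruence.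
Qed.

(** If both sides have collapsed to the same [DU s1], then both arguments reduce to [Du s1], so they
    are convertible in that case too. *)
Lemma El_inj s s' (A A' : dk) : dk_conv (DEl s A) (DEl s' A') -> dk_conv A A'.
Proof.
  intros H. apply dk_church_rosser in H as (v & H1 & H2).
  apply reds_from_El in H1 as [(A1 & -> & H1) | (s1 & -> & _ & H1)];
    apply reds_from_El in H2 as [(A2 & E & H2) | (s2 & E & _ & H2)];
    try discriminate; injection E; intros; subst;
    eapply dk_conv_trans; eauto using reds_dk_conv, dk_conv_sym.
Qed.

Lemma El_conv_U s s' (A : dk) :
  dk_conv (DEl s A) (DU s') -> axiom_rel P s' s /\ dk_conv A (Du s').
Proof.
  intros H. apply dk_church_rosser in H as (v & H1 & H2).
  apply reds_from_U in H2. subst.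
  apply reds_from_El in H1 as [(A1 & E & H1) | (s1 & E & ? & H1)]; [discriminate|].
  injection E as <-. auto using reds_dk_conv.
Qed.

Lemma Pi_not_U s (A B : dk) : ~ dk_conv (DPi A B) (DU s).
Proof.
  intros H. apply dk_church_rosser in H as (v & H1 & H2).
  apply reds_from_U in H2. apply reds_from_Pi in H1 as (? & ? & -> & _). discriminate.
Qed.

Lemma Pi_not_El s (A B C : dk) : ~ dk_conv (DPi A B) (DEl s C).
Proof.
  intros H. apply dk_church_rosser in H as (v & H1 & H2).
  apply reds_from_Pi in H1 as (? & ? & -> & _).
  apply reds_from_El in H2 as [(? & E & _) | (? & E & _)]; discriminate.
Qed.

Lemma ctx_closure_dsubst (R : dk -> dk -> Prop)
    (HR : forall t u f, R t u -> R (dsubst f t) (dsubst f u)) (t u : dk) :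
  ctx_closure R t u -> forall f, ctx_closure R (dsubst f t) (dsubst f u).
Proof. induction 1; simpl; intros f; auto using ctx_closure. Qed.

Lemma beta_root_dsubst (t u : dk) f :
  beta_root t u -> beta_root (dsubst f t) (dsubst f u).
Proof. destruct 1. rewrite dsubst_dsubst1. constructor. Qed.

Lemma dk_root_dsubst (t u : dk) f : dk_root t u -> dk_root (dsubst f t) (dsubst f u).
Proof.
  intros [H|H]; [left; now apply beta_root_dsubst | right].
  destruct H; econstructor; eauto.
Qed.

Lemma dk_conv_dsubst (t u : dk) f : dk_conv t u -> dk_conv (dsubst f t) (dsubst f u).
Proof.
  apply (cconv_map dk_root (dsubst f)).
  intros; now apply ctx_closure_dsubst; auto using dk_root_dsubst.
Qed.

Lemma dk_conv_dren (t u : dk) r : dk_conv t u -> dk_conv (dren r t) (dren r u).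
Proof. rewrite !dren_as_dsubst. apply dk_conv_dsubst. Qed.

Lemma dk_conv_dsubst_arg (t : dk) : forall f g,
  (forall n, dk_conv (f n) (g n)) -> dk_conv (dsubst f t) (dsubst g t).
Proof.
  assert (Hup : forall f g : nat -> dk, (forall n, dk_conv (f n) (g n)) ->
    forall n, dk_conv (dup f n) (dup g n)).
  { intros f g H [|m]; simpl; auto using dk_conv_refl, dk_conv_dren. }
  induction t; simpl; intros f g H; auto using dk_conv_refl;
    [apply cconv_Pi | apply cconv_Lam | apply cconv_App | apply cconv_El
    | apply cconv_Prod | apply cconv_abs | apply cconv_app];
    match goal with IH : _ -> _ |- cconv _ _ _ => eapply IH | _ => idtac end; auto.
Qed.

Lemma dk_conv_dsubst1 (M N N' : dk) :
  dk_conv N N' -> dk_conv (dsubst1 N M) (dsubst1 N' M).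
Proof. intros H. apply dk_conv_dsubst_arg. intros [|m]; auto using dk_conv_refl. Qed.

Lemma dk_conv_beta (A M N : dk) : dk_conv (DApp (DLam A M) N) (dsubst1 N M).
Proof. apply rst_step, cc_root. left. constructor. Qed.

(** * Strong normalization of beta *)

Inductive level : Type := Obj | Fam | Knd.

(* Objects, type families and kinds, separated syntactically; the annotation of
   an abstraction is left unconstrained. *)
Fixpoint has_level (l : level) (t : dk) : Prop :=
  match t, l with
  | DVar _, Obj => True
  | DSrt TYPE, Knd => True
  | DPi A B, Fam => has_level Fam A /\ has_level Fam B
  | DPi A B, Knd => has_level Fam A /\ has_level Knd B
  | DLam _ M, Obj => has_level Obj M
  | DLam _ M, Fam => has_level Fam M
  | DApp M N, Obj => has_level Obj M /\ has_level Obj N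
  | DApp M N, Fam => has_level Fam M /\ has_level Obj N
  | DU _, Fam => True
  | DEl _ A, Fam => has_level Obj A
  | Du _, Obj => True
  | DProd _ _ A B, Obj => has_level Obj A /\ has_level Obj B
  | Dabs _ _ A B M, Obj => has_level Obj A /\ has_level Obj B /\ has_level Obj M
  | Dapp _ _ A B M N, Obj =>
      has_level Obj A /\ has_level Obj B /\ has_level Obj M /\ has_level Obj N
  | _, _ => False
  end.

Lemma has_level_unique (t : dk) : forall l l', has_level l t -> has_level l' t -> l = l'.
Proof.
  induction t; intros [] []; simpl; try destruct k; try tauto; firstorder congruence.
Qed.

Lemma has_level_dren (t : dk) : forall l r, has_level l t -> has_level l (dren r t).
Proof. induction t; intros [] r; simpl; firstorder. Qed.

Lemma has_level_dsubst (t : dk) : forall l f,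
  (forall n, has_level Obj (f n)) -> has_level l t -> has_level l (dsubst f t).
Proof.
  assert (Hup : forall f, (forall n, has_level Obj (f n)) ->
    forall n, has_level Obj (dup f n)).
  { intros f Hf [|n]; simpl; auto. now apply has_level_dren. }
  induction t; intros [] f Hf; simpl; try tauto; auto;
    intuition auto.
Qed.

Lemma has_level_dsubst1 (M N : dk) l :
  has_level Obj N -> has_level l M -> has_level l (dsubst1 N M).
Proof. intros HN HM. apply has_level_dsubst; auto. intros [|n]; simpl; auto. Qed.

Lemma has_level_red (t u : dk) : dk_red t u -> forall l, has_level l t -> has_level l u.
Proof.
  induction 1 as [t u Hr| | | | | | | | | | | | | | | |];
    [ | intros []; simpl; intuition auto ..].
  destruct Hr as [Hr|Hr]; destruct Hr; intros []; simpl; try tauto;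
    intros []; now apply has_level_dsubst1.
Qed.

Lemma has_level_reds (t u : dk) :
  reds dk_root t u -> forall l, has_level l t -> has_level l u.
Proof. induction 1; intros l Hl; eauto using has_level_red. Qed.

Lemma has_level_conv (t u : dk) l l' :
  dk_conv t u -> has_level l t -> has_level l' u -> l = l'.
Proof.
  intros H Ht Hu. apply dk_church_rosser in H as (v & H1 & H2).
  exact (has_level_unique v l l' (has_level_reds _ _ H1 _ Ht) (has_level_reds _ _ H2 _ Hu)).
Qed.

(** * Erasure to simple types *)

Inductive styp : Type := Base | Arr (a b : styp).

(** Abstraction and application of families are transparent and [DEl] and [DU] share the skeleton
    [Base], so neither beta on families nor the rule for [El] changes the skeleton of a type. *)
Fixpoint skel (t : dk) : styp :=
  match t with
  | DPi A B => Arr (skel A) (skel B)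
  | DLam _ M => skel M
  | DApp M _ => skel M
  | _ => Base
  end.

(* On families and kinds the skeleton never looks at a variable. *)
Lemma skel_dsubst (t : dk) : forall l f, l <> Obj -> has_level l t ->
  skel (dsubst f t) = skel t.
Proof.
  induction t; intros [] f Hl; simpl; try tauto; intros H.
  - destruct H. rewrite (IHt1 Fam), (IHt2 Fam); easy.
  - destruct H. rewrite (IHt1 Fam), (IHt2 Knd); easy.
  - now apply (IHt2 Fam).
  - destruct H. now apply (IHt1 Fam).
Qed.

Lemma skel_dren (t : dk) l r : l <> Obj -> has_level l t -> skel (dren r t) = skel t.
Proof. rewrite dren_as_dsubst. apply skel_dsubst. Qed.

Lemma skel_red (t u : dk) : dk_red t u ->
  forall l, l <> Obj -> has_level l t -> skel t = skel u.
Proof.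
  assert (Fam <> Obj) by discriminate.
  induction 1 as [t u Hr| | | | | | | | | | | | | | | |]; intros l Hl Ht;
    [|destruct l; simpl in *; try tauto; try destruct Ht;
      first [reflexivity | solve [eauto] | f_equal; eauto] ..].
  destruct Hr as [Hr|Hr]; destruct Hr; simpl in *.
  - symmetry. apply (skel_dsubst _ l); auto. destruct l; tauto.
  - reflexivity.
  - destruct l; tauto.
Qed.

Lemma skel_reds (t u : dk) : reds dk_root t u ->
  forall l, l <> Obj -> has_level l t -> skel t = skel u.
Proof.
  induction 1 as [t u H | t | t u v H IH1 _ IH2]; intros l Hl Ht; eauto using skel_red.
  rewrite (IH1 l) by auto. apply (IH2 l); auto. now apply (has_level_reds _ _ H).
Qed.

Lemma skel_conv (t u : dk) l : dk_conv t u -> l <> Obj ->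
  has_level l t -> has_level l u -> skel t = skel u.
Proof.
  intros H Hl Ht Hu. apply dk_church_rosser in H as (v & H1 & H2).
  rewrite (skel_reds _ _ H1 l), (skel_reds _ _ H2 l); auto.
Qed.

(* Simple typing in Curry style: every Dedukti type former and constant becomes
   a simply typed constant. *)
Inductive stlc : list styp -> dk -> styp -> Prop :=
| st_Var G n a : nth_error G n = Some a -> stlc G (DVar n) a
| st_Srt G k : stlc G (DSrt k) Base
| st_Pi G A B a : stlc G A Base -> stlc (a :: G) B Base -> stlc G (DPi A B) Base
| st_Lam G A M a b : stlc G A Base -> stlc (a :: G) M b -> stlc G (DLam A M) (Arr a b)
| st_App G M N a b : stlc G M (Arr a b) -> stlc G N a -> stlc G (DApp M N) b
| st_U G s : stlc G (DU s) Base
| st_El G s A : stlc G A Base -> stlc G (DEl s A) Base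
| st_u G s : stlc G (Du s) Base
| st_Prod G s1 s2 A B :
    stlc G A Base -> stlc G B (Arr Base Base) -> stlc G (DProd s1 s2 A B) Base
| st_abs G s1 s2 A B M :
    stlc G A Base -> stlc G B (Arr Base Base) -> stlc G M (Arr Base Base) ->
    stlc G (Dabs s1 s2 A B M) Base
| st_app G s1 s2 A B M N :
    stlc G A Base -> stlc G B (Arr Base Base) -> stlc G M Base -> stlc G N Base ->
    stlc G (Dapp s1 s2 A B M N) Base.

(** [DSrt KIND] has no level, so the typing of a kind is recorded by an equation. *)
Definition typing_levels (M A : dk) : Prop :=
  (has_level Obj M /\ has_level Fam A) \/
  (has_level Fam M /\ has_level Knd A) \/
  (has_level Knd M /\ A = DSrt KIND).

Scheme dwf_mind := Minimality for dwf Sort Prop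
  with dtyped_mind := Minimality for dtyped Sort Prop.
Combined Scheme dwf_dtyped_ind from dwf_mind, dtyped_mind.

Lemma reds_from_Srt k (u : dk) : reds dk_root (DSrt k) u -> u = DSrt k.
Proof.
  intros H. apply clos_rt_rtn1 in H. induction H as [|u v Hs _ ->]; auto.
  inversion Hs as [? ? [Hr|Hr]| | | | | | | | | | | | | | | |]; subst; inversion Hr.
Qed.

(** In the conversion rule the new type is itself typed and hence has a level; this excludes that
    the old type was [KIND]. *)
Lemma KIND_conv_level l (t : dk) : dk_conv (DSrt KIND) t -> ~ has_level l t.
Proof.
  intros H Ht. apply dk_church_rosser in H as (v & H1 & H2).
  apply reds_from_Srt in H1 as ->. apply (has_level_reds _ _ H2) in Ht.
  destruct l; exact Ht.
Qed.

Lemma typing_levels_Srt (B : dk) k : typing_levels B (DSrt k) ->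
  (k = TYPE /\ has_level Fam B) \/ (k = KIND /\ has_level Knd B).
Proof.
  unfold typing_levels. destruct k; simpl; intuition congruence.
Qed.

Lemma typing_levels_conv (M A B : dk) k :
  typing_levels M A -> typing_levels B (DSrt k) -> dk_conv A B ->
  typing_levels M B /\ skel A = skel B.
Proof.
  intros HM HB H.
  assert (exists l, l <> Obj /\ has_level l B) as (l & Hl & HlB).
  { apply typing_levels_Srt in HB as [[_ ?]|[_ ?]]; eexists; split; eauto; discriminate. }
  destruct HM as [[? HA]|[[? HA]|[? ->]]]; [| |now apply KIND_conv_level in HlB].
  all: assert (E := has_level_conv _ _ _ _ H HA HlB); subst l.
  all: split; [unfold typing_levels; tauto | eapply skel_conv; eauto].
Qed.

Lemma typing_levels_Fam (M A : dk) :
  typing_levels M A -> has_level Fam A -> has_level Obj M.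
Proof.
  intros [[? ?]|[[? HA]|[? ->]]] HA'; auto.
  - discriminate (has_level_unique _ _ _ HA HA').
  - destruct HA'.
Qed.

Lemma typing_levels_Knd (M A : dk) :
  typing_levels M A -> has_level Knd A -> has_level Fam M.
Proof.
  intros [[? HA]|[[? ?]|[? ->]]] HA'; auto.
  - discriminate (has_level_unique _ _ _ HA HA').
  - destruct HA'.
Qed.

(** Levels and erased typing are proved together: conversion keeps the skeleton because both types
    have the same level above [Obj], and application keeps it because the codomain is a family or a
    kind, whose skeleton ignores substitution. *)
Lemma dtyped_levels :
  (forall G : dkctx P, dwf G -> Forall (has_level Fam) G) /\
  (forall (G : dkctx P) M A, dtyped G M A ->
     Forall (has_level Fam) G /\ typing_levels M A /\ stlc (map skel G) M (skel A)).
Proof.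
  apply dwf_dtyped_ind; intros;
    repeat match goal with H : Forall _ _ /\ _ |- _ =>
      let a := fresh "HG" in let b := fresh "HL" in let c := fresh "HS" in
      destruct H as (a & b & c) end.
  - constructor.
  - constructor; auto. now apply typing_levels_Srt in HL as [[_ ?]|[? _]].
  - destruct (typing_levels_conv _ _ _ _ HL0 HL H3) as [? <-]. auto.
  - repeat split; [auto | | constructor]. right. right. simpl. auto.
  - assert (has_level Fam A) by (eapply Forall_forall; eauto using nth_error_In).
    repeat split; auto.
    + left. split; [exact I | now apply has_level_dren].
    + rewrite (skel_dren _ Fam) by (auto; discriminate).
      constructor. rewrite nth_error_map, H1. reflexivity.
  - repeat split; auto; [|econstructor; eauto].
    apply typing_levels_Srt in HL0 as [[_ HA]|[? _]]; [|discriminate].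
    apply typing_levels_Srt in HL as [[-> HB]|[-> HB]]; right; [left | right]; simpl; auto.
  - repeat split; auto; [|simpl; constructor; auto].
    apply typing_levels_Srt in HL1 as [[_ HA]|[? _]]; [|discriminate].
    apply typing_levels_Srt in HL0 as [[_ HB]|[_ HB]].
    + left. simpl. eauto using typing_levels_Fam.
    + right. left. simpl. eauto using typing_levels_Knd.
  - assert (has_level Obj N /\ exists l, l <> Obj /\ has_level l B) as (HN & l & Hl & HB).
    { destruct HL0 as [[_ [HA HB]]|[[_ [HA HB]]|[_ ?]]]; [| |discriminate];
        (split; [eapply typing_levels_Fam; eauto | eexists; split; eauto; discriminate]). }
    repeat split; auto.
    + destruct HL0 as [[HM [_ HB']]|[[HM [_ HB']]|[_ ?]]]; [left|right;left|discriminate];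
        simpl; auto using has_level_dsubst1.
    + unfold dsubst1. rewrite (skel_dsubst _ l) by auto. econstructor; eauto.
  - repeat split; auto; [|constructor]. right. left. simpl. auto.
  - repeat split; auto; [|now constructor]. right. left. simpl.
    split; auto. eapply typing_levels_Fam; eauto. exact I.
  - repeat split; auto; [|constructor]. left. simpl. auto.
  - assert (has_level Obj A) by (eapply typing_levels_Fam; eauto; exact I).
    repeat split; auto; [|constructor; auto]. left. simpl. repeat split; auto.
    eapply typing_levels_Fam; eauto. simpl. auto.
  - assert (has_level Obj A) by (eapply typing_levels_Fam; eauto; exact I).
    assert (has_level Obj B) by (eapply typing_levels_Fam; eauto; simpl; auto).
    repeat split; auto; [|constructor; auto]. left. simpl. repeat split; auto.
    eapply typing_levels_Fam; eauto. simpl. auto using has_level_dren.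
  - assert (has_level Obj A) by (eapply typing_levels_Fam; eauto; exact I).
    assert (has_level Obj B) by (eapply typing_levels_Fam; eauto; simpl; auto).
    assert (has_level Obj N) by (eapply typing_levels_Fam; eauto; simpl; auto).
    repeat split; auto; [|constructor; auto]. left. simpl. repeat split; auto.
    eapply typing_levels_Fam; eauto. simpl. auto.
Qed.

(** * Reducibility *)

Inductive sn (t : dk) : Prop := sn_intro : (forall u, dk_beta t u -> sn u) -> sn t.

Fixpoint reducible (a : styp) (t : dk) : Prop :=
  match a with
  | Base => sn t
  | Arr a b => forall u, reducible a u -> reducible b (DApp t u)
  end.

(** Constants with their arguments and [DPi] count as neutral: under beta alone, only an abstraction
    reacts to being applied. *)
Definition neutral (t : dk) : Prop := match t with DLam _ _ => False | _ => True end.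

Lemma sn_preimage (F : dk -> dk) (HF : forall t u, dk_beta t u -> dk_beta (F t) (F u)) t :
  sn (F t) -> sn t.
Proof.
  intros H. remember (F t) as v eqn:E. revert t E.
  induction H as [v _ IH]; intros t ->. constructor. intros u Hu. eapply IH; eauto.
Qed.

(** Girard's conditions CR1 to CR3. They are proved simultaneously because CR1 at an arrow applies
    the term to a variable, which is reducible by CR3 at the domain. *)
Lemma reducible_props a :
  (forall t, reducible a t -> sn t) /\
  (forall t u, reducible a t -> dk_beta t u -> reducible a u) /\
  (forall t, neutral t -> (forall u, dk_beta t u -> reducible a u) -> reducible a t).
Proof.
  induction a as [|a (IHa1 & IHa2 & IHa3) b (IHb1 & IHb2 & IHb3)]; simpl.
  - split; [|split]; auto.
    + intros t u Ht Hu. destruct Ht; auto.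
    + intros t _ H. constructor. exact H.
  - split; [|split].
    + intros t Ht. apply (sn_preimage (fun x => DApp x (DVar 0))).
      { intros; now apply cc_App1. }
      apply IHb1, Ht, IHa3; [exact I|].
      intros u Hu. inversion Hu as [? ? Hr| | | | | | | | | | | | | | | |]. inversion Hr.
    + intros t u Ht Hu v Hv. eapply IHb2; eauto. now apply cc_App1.
    + intros t Hn Ht u Hu. assert (Hs := IHa1 _ Hu).
      induction Hs as [u _ IHu]. apply IHb3; [exact I|].
      intros v Hv. inversion Hv as [? ? Hr| | | | | | | | | | | | | | | |]; subst; eauto.
      inversion Hr; subst. destruct Hn.
Qed.

Lemma reducible_sn a t : reducible a t -> sn t.
Proof. apply reducible_props. Qed.

Lemma reducible_step a t u : reducible a t -> dk_beta t u -> reducible a u.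
Proof. apply reducible_props. Qed.

Lemma reducible_neutral a t :
  neutral t -> (forall u, dk_beta t u -> reducible a u) -> reducible a t.
Proof. apply reducible_props. Qed.

Lemma reducible_Var a n : reducible a (DVar n).
Proof.
  apply reducible_neutral; [exact I|].
  intros u Hu. inversion Hu as [? ? Hr| | | | | | | | | | | | | | | |]. inversion Hr.
Qed.

Lemma dk_beta_dsubst (t u : dk) f : dk_beta t u -> dk_beta (dsubst f t) (dsubst f u).
Proof. intros H. apply ctx_closure_dsubst; auto using beta_root_dsubst. Qed.

Lemma sn_under_binder a (M : dk) :
  (forall N, reducible a N -> sn (dsubst1 N M)) -> sn M.
Proof.
  intros H. apply (sn_preimage (dsubst1 (DVar 0))).
  - intros; now apply dk_beta_dsubst.
  - apply H, reducible_Var.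
Qed.

(** The redex [DApp (DLam A M) N] can step in its annotation, body or argument, hence the assumption
    [sn A] and three nested inductions on [sn]; contraction at the root is the hypothesis on
    [dsubst1 N M]. *)
Lemma reducible_Lam a b A M : sn A ->
  (forall N, reducible a N -> reducible b (dsubst1 N M)) -> reducible (Arr a b) (DLam A M).
Proof.
  intros HA HM N HN. simpl in HM.
  assert (HsM : sn M) by eauto using sn_under_binder, reducible_sn.
  assert (HsN := reducible_sn _ _ HN).
  revert M HsM HM N HN HsN. induction HA as [A HA IHA].
  intros M HsM. induction HsM as [M HsM IHM]. intros HM N HN HsN.
  induction HsN as [N HsN IHN].
  pose proof (sn_intro _ HsM). pose proof (sn_intro _ HsN).
  apply reducible_neutral; [exact I|].
  intros u Hu. inversion Hu as [? ? Hr| | | | |? ? ? Hl| | | | | | | | | | |]; subst.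
  - inversion Hr; subst. auto.
  - inversion Hl as [? ? Hr| | | | | | | | | | | | | | | |]; subst; [inversion Hr| |].
    + now apply IHA.
    + apply IHM; auto.
      intros N' HN'. apply (reducible_step _ _ _ (HM N' HN')). now apply dk_beta_dsubst.
  - apply IHN; auto. eapply reducible_step; eauto.
Qed.

Ltac sn_constructor :=
  constructor; intros u Hu;
  inversion Hu as [? ? Hr| | | | | | | | | | | | | | | |]; subst;
  [inversion Hr | ..]; unfold dk_beta in *; eauto using sn_intro.

Lemma sn_Pi (A B : dk) : sn A -> sn B -> sn (DPi A B).
Proof.
  intros HA. revert B. induction HA as [A HA IHA]. intros B HB.
  induction HB as [B HB IHB]. sn_constructor.
Qed.

Lemma sn_El s (A : dk) : sn A -> sn (DEl s A).
Proof. induction 1 as [A HA IHA]. sn_constructor. Qed.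

Lemma sn_Prod s1 s2 (A B : dk) : sn A -> sn B -> sn (DProd s1 s2 A B).
Proof.
  intros HA. revert B. induction HA as [A HA IHA]. intros B HB.
  induction HB as [B HB IHB]. sn_constructor.
Qed.

Lemma sn_abs s1 s2 (A B M : dk) : sn A -> sn B -> sn M -> sn (Dabs s1 s2 A B M).
Proof.
  intros HA. revert B M. induction HA as [A HA IHA]. intros B M HB. revert M.
  induction HB as [B HB IHB]. intros M HM.
  induction HM as [M HM IHM]. sn_constructor.
Qed.

Lemma sn_app s1 s2 (A B M N : dk) :
  sn A -> sn B -> sn M -> sn N -> sn (Dapp s1 s2 A B M N).
Proof.
  intros HA. revert B M N. induction HA as [A HA IHA]. intros B M N HB. revert M N.
  induction HB as [B HB IHB]. intros M N HM. revert N.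
  induction HM as [M HM IHM]. intros N HN.
  induction HN as [N HN IHN]. sn_constructor.
Qed.

Lemma sn_atom (t : dk) : (forall u, ~ dk_beta t u) -> sn t.
Proof. intros H. constructor. intros u Hu. now apply H in Hu. Qed.

(** The fundamental lemma of the method, generalized over reducible substitutions so that it passes
    under binders; the identity substitution then gives [dtyped_sn]. *)
Lemma stlc_reducible G (M : dk) a : stlc G M a ->
  forall f, (forall n b, nth_error G n = Some b -> reducible b (f n)) ->
  reducible a (dsubst f M).
Proof.
  assert (Hcons : forall G f a N,
    (forall n b, nth_error G n = Some b -> reducible b (f n)) -> reducible a N ->
    forall n b, nth_error (a :: G) n = Some b -> reducible b (dcons N f n)).
  { intros G' f a' N Hf HN [|n] b; simpl; [now intros [= <-] | apply Hf]. }
  assert (Hatom : forall t : dk, match t with DSrt _ | DU _ | Du _ => True | _ => False end ->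
    sn t).
  { intros t Ht. apply sn_atom. intros u Hu. destruct t; try destruct Ht;
      inversion Hu as [? ? Hr| | | | | | | | | | | | | | | |]; inversion Hr. }
  induction 1; intros f Hf; simpl; auto.
  - apply sn_Pi; [now apply IHstlc1|]. apply (sn_under_binder a). intros N HN.
    rewrite dsubst1_dup. exact (IHstlc2 _ (Hcons _ _ _ _ Hf HN)).
  - apply (reducible_Lam a b); [now apply IHstlc1|]. intros N HN.
    rewrite dsubst1_dup. exact (IHstlc2 _ (Hcons _ _ _ _ Hf HN)).
  - exact (IHstlc1 f Hf _ (IHstlc2 f Hf)).
  - apply sn_El. now apply IHstlc.
  - apply sn_Prod; [apply (reducible_sn Base) | apply (reducible_sn (Arr Base Base))]; auto.
  - apply sn_abs; [apply (reducible_sn Base) | apply (reducible_sn (Arr Base Base)) ..]; auto.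
  - apply sn_app; [| apply (reducible_sn (Arr Base Base)) | |];
      try apply (reducible_sn Base); auto.
Qed.

Lemma dtyped_sn (G : dkctx P) M A : dtyped G M A -> sn M.
Proof.
  intros H. apply dtyped_levels in H as (_ & _ & H).
  rewrite <- (dsubst_id M DVar) by auto.
  eapply reducible_sn, stlc_reducible; eauto using reducible_Var.
Qed.

(** Existence follows the induction on [sn], with excluded middle deciding whether a step is left;
    uniqueness is confluence of beta alone. *)
Lemma dtyped_has_nf (G : dkctx P) M A : dtyped G M A -> exists N, unique (beta_nf_of M) N.
Proof.
  intros H.
  assert (exists N, beta_nf_of M N) as [N [HN HnN]].
  { apply dtyped_sn in H. induction H as [M _ IH].
    destruct (classic (exists M', dk_beta M M')) as [[M' HM']|Hn].
    - destruct (IH _ HM') as [N [? ?]]. exists N. split; auto.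
      eapply rt_trans; eauto. now apply rt_step.
    - exists M. split; auto. apply rt_refl. }
  exists N. split; [now split|]. intros N' [HN' HnN'].
  assert (Hnf : forall t u : dk, ~ (exists t', dk_beta t t') -> reds (@beta_root P) t u -> t = u).
  { intros t u Ht Htu. apply clos_rt_rt1n in Htu. destruct Htu; auto.
    exfalso; apply Ht; eexists; eauto. }
  destruct (beta_church_rosser N N') as (v & H1 & H2).
  - apply rst_trans with M; [apply rst_sym|]; now apply reds_cconv.
  - apply Hnf in H1, H2; auto. congruence.
Qed.

(** * Typing of objects up to unrestricted conversion *)

(* Neither contexts nor types need to be well formed, which makes renaming,
   substitution and conversion of contexts available without any soundness
   result for the translation. *)
Inductive oty : dkctx P -> dk -> dk -> Prop :=
| oty_conv G M A B : oty G M A -> dk_conv A B -> oty G M B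
| oty_var G n A : nth_error G n = Some A -> oty G (DVar n) (dren (Nat.add (S n)) A)
| oty_lam G A B M : oty (A :: G) M B -> oty G (DLam A M) (DPi A B)
| oty_app G A B M N : oty G M (DPi A B) -> oty G N A -> oty G (DApp M N) (dsubst1 N B)
| oty_u G s1 s2 : axiom_rel P s1 s2 -> oty G (Du s1) (DU s2)
| oty_Prod G s1 s2 s3 A B :
    rule_rel P s1 s2 s3 -> oty G A (DU s1) -> oty G B (DPi (DEl s1 A) (DU s2)) ->
    oty G (DProd s1 s2 A B) (DU s3)
| oty_cabs G s1 s2 s3 A B M :
    rule_rel P s1 s2 s3 -> oty G A (DU s1) -> oty G B (DPi (DEl s1 A) (DU s2)) ->
    oty G M (DPi (DEl s1 A) (DEl s2 (DApp (dren S B) (DVar 0)))) ->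
    oty G (Dabs s1 s2 A B M) (DEl s3 (DProd s1 s2 A B))
| oty_capp G s1 s2 s3 A B M N :
    rule_rel P s1 s2 s3 -> oty G A (DU s1) -> oty G B (DPi (DEl s1 A) (DU s2)) ->
    oty G M (DEl s3 (DProd s1 s2 A B)) -> oty G N (DEl s1 A) ->
    oty G (Dapp s1 s2 A B M N) (DEl s2 (DApp B N)).

#[local] Hint Constructors oty : core.

(** The level discards derivations for families and kinds, and in the remaining rules it passes to
    exactly the subterms that [oty] types. *)
Lemma dtyped_oty (G : dkctx P) M A : dtyped G M A -> has_level Obj M -> oty G M A.
Proof.
  induction 1; simpl; intros HL; try tauto;
    repeat match goal with H : _ /\ _ |- _ => destruct H end; eauto 9.
Qed.

Lemma oty_inv G M T : oty G M T ->
  match M with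
  | DVar n => exists A, nth_error G n = Some A /\ dk_conv T (dren (Nat.add (S n)) A)
  | DLam A M => exists B, oty (A :: G) M B /\ dk_conv T (DPi A B)
  | DApp M N => exists A B,
      oty G M (DPi A B) /\ oty G N A /\ dk_conv T (dsubst1 N B)
  | Du s => exists s2, axiom_rel P s s2 /\ dk_conv T (DU s2)
  | DProd s1 s2 A B => exists s3, rule_rel P s1 s2 s3 /\
      oty G A (DU s1) /\ oty G B (DPi (DEl s1 A) (DU s2)) /\ dk_conv T (DU s3)
  | Dabs s1 s2 A B M => exists s3, rule_rel P s1 s2 s3 /\
      oty G A (DU s1) /\ oty G B (DPi (DEl s1 A) (DU s2)) /\
      oty G M (DPi (DEl s1 A) (DEl s2 (DApp (dren S B) (DVar 0)))) /\
      dk_conv T (DEl s3 (DProd s1 s2 A B))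
  | Dapp s1 s2 A B M N => exists s3, rule_rel P s1 s2 s3 /\
      oty G A (DU s1) /\ oty G B (DPi (DEl s1 A) (DU s2)) /\
      oty G M (DEl s3 (DProd s1 s2 A B)) /\ oty G N (DEl s1 A) /\
      dk_conv T (DEl s2 (DApp B N))
  | _ => False
  end.
Proof.
  induction 1 as [G M A B H IH HAB| | | | | | |].
  2-8: repeat eexists; eauto using dk_conv_refl.
  destruct M; try exact IH;
    repeat match goal with H : exists _, _ |- _ => destruct H end;
    repeat eexists; intuition eauto using dk_conv_trans, dk_conv_sym.
Qed.

Lemma oty_dren G M T : oty G M T -> forall G' r,
  (forall n A, nth_error G n = Some A ->
     exists A', nth_error G' (r n) = Some A' /\
       dren (Nat.add (S (r n))) A' = dren r (dren (Nat.add (S n)) A)) ->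
  oty G' (dren r M) (dren r T).
Proof.
  induction 1; intros G' r Hr; simpl in *; eauto 9.
  - eapply oty_conv; eauto using dk_conv_dren.
  - destruct (Hr _ _ H) as (A' & HA' & <-). now apply oty_var.
  - apply oty_lam, IHoty. intros [|n] C; simpl; intros HC.
    + injection HC as <-. eexists; split; eauto 9. now rewrite !dren_dren.
    + destruct (Hr _ _ HC) as (C' & HC' & E). exists C'. split; auto.
      apply (f_equal (dren S)) in E. rewrite !dren_dren in *. exact E.
  - rewrite dren_dsubst1. eapply oty_app; eauto 9.
  - eapply oty_cabs; eauto 9.
    specialize (IHoty3 _ _ Hr). rewrite dren_up_S in IHoty3. exact IHoty3.
Qed.

Lemma oty_weaken G M T A : oty G M T -> oty (A :: G) (dren S M) (dren S T).
Proof.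
  intros H. eapply oty_dren; eauto 9. intros n B HB. exists B. split; auto.
  now rewrite dren_dren.
Qed.

Lemma oty_var0 G A : oty (A :: G) (DVar 0) (dren S A).
Proof. exact (oty_var (A :: G) 0 A eq_refl). Qed.

Lemma oty_dsubst G M T : oty G M T -> forall G' f,
  (forall n A, nth_error G n = Some A ->
     oty G' (f n) (dsubst f (dren (Nat.add (S n)) A))) ->
  oty G' (dsubst f M) (dsubst f T).
Proof.
  induction 1; intros G' f Hf; simpl in *; eauto 9.
  - eapply oty_conv; eauto using dk_conv_dsubst.
  - apply oty_lam, IHoty. intros [|n] C; simpl; intros HC.
    + injection HC as <-. change (Nat.add 1) with S. rewrite dsubst_dup_S. apply oty_var0.
    + apply Hf in HC. apply (oty_weaken _ _ _ (dsubst f A)) in HC.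
      rewrite dren_dsubst, dsubst_dren in HC. rewrite dsubst_dren. exact HC.
  - rewrite dsubst_dsubst1. eapply oty_app; eauto 9.
  - eapply oty_cabs; eauto 9.
    specialize (IHoty3 _ _ Hf). rewrite dsubst_dup_S in IHoty3. exact IHoty3.
Qed.

Lemma oty_dsubst1 G A M T N : oty (A :: G) M T -> oty G N A ->
  oty G (dsubst1 N M) (dsubst1 N T).
Proof.
  intros HM HN. eapply oty_dsubst; eauto 9. intros [|n] C; simpl; intros HC.
  - injection HC as <-. now rewrite dsubst_dren, dsubst_id.
  - rewrite dsubst_dren. apply oty_var in HC. rewrite dren_as_dsubst in HC. exact HC.
Qed.

(** This is the identity substitution seen as a map between the two contexts: only index 0 has a new
    declared type, which [oty_conv] repairs. *)
Lemma oty_ctx_conv G A A' M T : oty (A :: G) M T -> dk_conv A A' -> oty (A' :: G) M T.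
Proof.
  intros H HA. rewrite <- (dsubst_id M DVar), <- (dsubst_id T DVar) by auto.
  eapply oty_dsubst; eauto 9. intros n C HC. rewrite dsubst_id by auto.
  destruct n; simpl in HC.
  - injection HC as <-. eapply oty_conv; [apply oty_var0|].
    apply dk_conv_dren, dk_conv_sym, HA.
  - exact (oty_var (A' :: G) (S n) C HC).
Qed.

Lemma dk_beta_conv (t u : dk) : dk_beta t u -> dk_conv t u.
Proof.
  intros H. apply rst_step. unfold dk_red. induction H; auto using ctx_closure.
Qed.

(** The redex case rests on injectivity of products. A step in an argument also changes the types of
    sibling premises or of the result; since conversion in [oty] is unrestricted, these are repaired
    with no typing obligation. *)
Lemma oty_beta G M T : oty G M T -> forall M', dk_beta M M' -> oty G M' T.
Proof.
  induction 1; intros M' HM'; eauto using oty;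
    inversion HM' as [? ? Hr| | | | | | | | | | | | | | | |]; subst; try (now inversion Hr);
    try match goal with H : ctx_closure _ _ _ |- _ => assert (Hc := dk_beta_conv _ _ H) end;
    eauto 9.
  - eapply oty_conv; [apply oty_lam; eapply oty_ctx_conv; eauto 9|].
    apply cconv_Pi; [apply dk_conv_sym, Hc | apply rst_refl].
  - inversion Hr; subst. apply oty_inv in H as (B' & HM & HPi).
    apply Pi_inj in HPi as [HA HB].
    eapply oty_conv; [eapply oty_dsubst1; eauto using oty_conv|].
    apply dk_conv_dsubst, dk_conv_sym, HB.
  - eapply oty_conv; [eapply oty_app; eauto 9|]. apply dk_conv_dsubst1, dk_conv_sym, Hc.
  - eapply oty_Prod; eauto 9. eapply oty_conv; eauto 9.
    apply cconv_Pi; [apply cconv_El, Hc | apply rst_refl].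
  - eapply oty_conv; [eapply oty_cabs; eauto 9; eapply oty_conv; eauto 9;
      (apply cconv_Pi; [apply cconv_El, Hc | apply rst_refl])|].
    apply cconv_El, cconv_Prod; [apply dk_conv_sym, Hc | apply rst_refl].
  - eapply oty_conv; [eapply oty_cabs; eauto 9; eapply oty_conv; eauto 9|].
    + apply cconv_Pi, cconv_El, cconv_App; try apply rst_refl. apply dk_conv_dren, Hc.
    + apply cconv_El, cconv_Prod; [apply rst_refl | apply dk_conv_sym, Hc].
  - eapply oty_capp; eauto 9; eapply oty_conv; eauto 9.
    + apply cconv_Pi; [apply cconv_El, Hc | apply rst_refl].
    + apply cconv_El, cconv_Prod; [exact Hc | apply rst_refl].
    + apply cconv_El, Hc.
  - eapply oty_conv; [eapply oty_capp; eauto 9; eapply oty_conv; eauto 9|].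
    + apply cconv_El, cconv_Prod; [apply rst_refl | exact Hc].
    + apply cconv_El, cconv_App; [apply dk_conv_sym, Hc | apply rst_refl].
  - eapply oty_conv; [eapply oty_capp; eauto 9|].
    apply cconv_El, cconv_App; [apply rst_refl | apply dk_conv_sym, Hc].
Qed.

Lemma oty_betas G M M' T :
  clos_refl_trans dk (@dk_beta P) M M' -> oty G M T -> oty G M' T.
Proof. induction 1; eauto using oty_beta. Qed.

(** * The inverse translation reflects conversion *)

Lemma conv_map (F : term -> term) :
  (forall x y, red x y -> red (F x) (F y)) -> forall x y, conv x y -> conv (F x) (F y).
Proof.
  intros HF x y H. induction H.
  - apply rst_step; auto.
  - apply rst_refl.
  - apply rst_sym; auto.
  - eapply rst_trans; eauto.
Qed.

Lemma conv_Pi s1 s2 (A A' B B' : term) :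
  conv A A' -> conv B B' -> conv (Pi s1 s2 A B) (Pi s1 s2 A' B').
Proof.
  intros; apply rst_trans with (Pi s1 s2 A' B);
    [apply (conv_map (fun x => Pi s1 s2 x B)) | apply conv_map]; eauto using red.
Qed.

Lemma conv_Lam s1 s2 (A A' B B' M M' : term) :
  conv A A' -> conv B B' -> conv M M' -> conv (Lam s1 s2 A B M) (Lam s1 s2 A' B' M').
Proof.
  intros; apply rst_trans with (Lam s1 s2 A' B M);
    [apply (conv_map (fun x => Lam s1 s2 x B M)); eauto using red|].
  apply rst_trans with (Lam s1 s2 A' B' M);
    [apply (conv_map (fun x => Lam s1 s2 A' x M)) | apply conv_map]; eauto using red.
Qed.

Lemma conv_App s1 s2 (A A' B B' M M' N N' : term) :
  conv A A' -> conv B B' -> conv M M' -> conv N N' ->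
  conv (App s1 s2 A B M N) (App s1 s2 A' B' M' N').
Proof.
  intros; apply rst_trans with (App s1 s2 A' B M N);
    [apply (conv_map (fun x => App s1 s2 x B M N)); eauto using red|].
  apply rst_trans with (App s1 s2 A' B' M N);
    [apply (conv_map (fun x => App s1 s2 A' x M N)); eauto using red|].
  apply rst_trans with (App s1 s2 A' B' M' N);
    [apply (conv_map (fun x => App s1 s2 A' B' x N)) | apply conv_map]; eauto using red.
Qed.

Lemma red_subst (t u : term) : red t u -> forall f, red (subst f t) (subst f u).
Proof.
  induction 1; simpl; intros f; eauto using red.
  rewrite subst_subst1. eapply red_beta; eauto.
Qed.

Lemma conv_subst (t u : term) f : conv t u -> conv (subst f t) (subst f u).
Proof. apply conv_map. intros; now apply red_subst. Qed.

Lemma ren_as_subst (t : term) r : ren r t = subst (fun n => Var (r n)) t.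
Proof.
  rewrite <- (subst_id (ren r t) Var) by auto. now rewrite subst_ren.
Qed.

Lemma conv_subst_arg (t : term) : forall f g,
  (forall n, conv (f n) (g n)) -> conv (subst f t) (subst g t).
Proof.
  assert (Hup : forall f g : nat -> term, (forall n, conv (f n) (g n)) ->
    forall n, conv (up f n) (up g n)).
  { intros f g H [|m]; simpl; [apply rst_refl|]. rewrite !ren_as_subst.
    now apply conv_subst. }
  induction t; simpl; intros f g H; auto; try apply rst_refl;
    [apply conv_Pi | apply conv_Lam | apply conv_App]; auto.
Qed.

Lemma conv_subst1 (M M' N N' : term) :
  conv M M' -> conv N N' -> conv (subst1 N M) (subst1 N' M').
Proof.
  intros HM HN. apply rst_trans with (subst1 N M'); [now apply conv_subst|].
  apply conv_subst_arg. intros [|n]; auto. apply rst_refl.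
Qed.

Lemma untr_dren (t : dk) : invertible t -> forall r,
  invertible (dren r t) /\ untr (dren r t) = ren r (untr t).
Proof.
  induction 1; intros r; simpl;
    repeat match goal with IH : forall r, invertible (dren r ?t) /\ _ |- _ =>
      let a := fresh in let b := fresh in
      pose proof (fun r => proj1 (IH r)) as a; pose proof (fun r => proj2 (IH r)) as b;
      clear IH; try rewrite !b end;
    (split; [auto using invertible | rewrite ?ren_subst1; congruence]).
Qed.

Lemma untr_dsubst (t : dk) : invertible t -> forall f g,
  (forall n, invertible (f n) /\ untr (f n) = g n) ->
  invertible (dsubst f t) /\ untr (dsubst f t) = subst g (untr t).
Proof.
  assert (Hup : forall (f : nat -> dk) g, (forall n, invertible (f n) /\ untr (f n) = g n) ->
    forall n, invertible (dup f n) /\ untr (dup f n) = up g n).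
  { intros f g H [|n]; simpl; [auto using invertible|].
    destruct (H n) as [Hi <-]. now apply untr_dren. }
  induction 1; intros f g Hfg; simpl; auto using invertible;
    assert (Hfg' := Hup _ _ Hfg);
    repeat match goal with IH : forall f g, _ -> invertible (dsubst f ?t) /\ _ |- _ =>
      let a := fresh in
      first [ destruct (IH _ _ Hfg) as [? a]; rewrite a; clear IH
            | destruct (IH _ _ Hfg') as [? a]; rewrite a; clear IH ] end;
    (split; [auto using invertible | rewrite ?subst_subst1; reflexivity]).
Qed.

Lemma untr_dsubst1 (M N : dk) : invertible M -> invertible N ->
  invertible (dsubst1 N M) /\ untr (dsubst1 N M) = subst1 (untr N) (untr M).
Proof.
  intros HM HN. apply untr_dsubst; auto. intros [|n]; simpl; auto using invertible.
Qed.

Lemma red_from_Lam (A M u : dk) : dk_red (DLam A M) u ->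
  exists A' M', u = DLam A' M' /\ (M' = M \/ dk_red M M').
Proof.
  intros H. inversion H as [? ? [Hr|Hr]| | | | | | | | | | | | | | | |]; subst;
    [inversion Hr | inversion Hr | |]; eauto 6.
Qed.

(** A root beta step and a step in an annotation are invisible to [untr], the rule for [app] becomes
    an EPTS beta step, and the rule for [El] can fire only inside annotations. The conclusion is a
    conversion because a step in [M] or [N] of [DApp (DLam T M) N] happens under the substitution
    performed by [untr], which may copy or erase [N]. *)
Lemma untr_red (t : dk) : invertible t -> forall u, dk_red t u ->
  invertible u /\ conv (untr t) (untr u).
Proof.
  assert (Hrefl : forall a : term, conv a a) by (intros; apply rst_refl).
  assert (Hbody : forall M : dk, invertible M ->
    (forall u, dk_red M u -> invertible u /\ conv (untr M) (untr u)) ->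
    forall M', M' = M \/ dk_red M M' -> invertible M' /\ conv (untr M) (untr M')).
  { intros M HM IH M' [->|H]; auto. }
  induction 1; intros u Hu;
    inversion Hu as [? ? [Hr|Hr]| | | | | | | | | | | | | | | |]; subst;
    try (now inversion Hr);
    repeat match goal with
    | H : ctx_closure _ (DLam _ _) _ |- _ =>
        apply red_from_Lam in H as (? & ? & -> & H)
    end;
    repeat match goal with
    | IH : forall u, dk_red ?t u -> _, H : ctx_closure _ ?t _ |- _ =>
        destruct (IH _ H); clear H
    | Hi : invertible ?M, IH : forall u, dk_red ?M u -> _, H : _ = ?M \/ dk_red ?M _ |- _ =>
        destruct (Hbody _ Hi IH _ H); clear H
    end; simpl;
    try solve [split; auto using invertible, conv_Pi, conv_Lam, conv_App, conv_subst1].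
  - inversion Hr; subst. destruct (untr_dsubst1 M N) as [? ->]; auto.
  - inversion Hr; subst.
    (* Invertibility forces the last argument of [Dabs] to be an abstraction, so the reduct is an
       invertible beta redex whose inverse is the EPTS contractum. *)
    match goal with H : invertible (Dabs _ _ _ _ _) |- _ => inversion H; subst end.
    split; [auto using invertible|]. simpl. eapply rst_step, red_beta; eauto.
Qed.

Lemma untr_reds (t u : dk) : reds dk_root t u -> invertible t ->
  invertible u /\ conv (untr t) (untr u).
Proof.
  induction 1 as [t u H | t | t u v _ IH1 _ IH2]; intros Ht.
  - now apply untr_red.
  - split; auto. apply rst_refl.
  - destruct (IH1 Ht) as [Hu ?]. destruct (IH2 Hu). split; auto. eapply rst_trans; eauto.
Qed.

Lemma tr_invertible (t : term) : invertible (tr t).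
Proof. induction t; simpl; auto using invertible. Qed.

Lemma tr_Obj (t : term) : has_level Obj (tr t).
Proof. induction t; simpl; auto. Qed.

Lemma untr_tr (t : term) : untr (tr t) = t.
Proof. induction t; simpl; congruence. Qed.

Lemma tr_ren (t : term) : forall r, tr (ren r t) = dren r (tr t).
Proof. induction t; simpl; congruence. Qed.

Lemma tr_subst (t : term) : forall f g, (forall n, tr (f n) = g n) ->
  tr (subst f t) = dsubst g (tr t).
Proof.
  assert (Hup : forall (f : nat -> term) g, (forall n, tr (f n) = g n) ->
    forall n, tr (up f n) = dup g n).
  { intros f g H [|n]; simpl; auto. now rewrite tr_ren, H. }
  induction t; simpl; intros f g H; auto;
    repeat match goal with IH : forall f g, _ -> tr (subst f ?t) = _ |- _ =>
      first [rewrite (IH _ _ H) | rewrite (IH _ _ (Hup _ _ H))]; clear IH end; reflexivity.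
Qed.

Lemma tr_subst1 (N M : term) : tr (subst1 N M) = dsubst1 (tr N) (tr M).
Proof. apply tr_subst. now intros [|n]. Qed.

Lemma tr_reflects_conv (A B : term) : dk_conv (tr A) (tr B) -> conv A B.
Proof.
  intros H. apply dk_church_rosser in H as (v & H1 & H2).
  apply untr_reds in H1 as [_ H1]; [|apply tr_invertible].
  apply untr_reds in H2 as [_ H2]; [|apply tr_invertible].
  rewrite untr_tr in H1, H2. eapply rst_trans; [|apply rst_sym]; eauto.
Qed.

(** * Conservativity *)

Lemma tr_ctx_wf (G : ctx P) D : tr_ctx G D -> wf G.
Proof. destruct 1; econstructor; eauto. Qed.

Lemma tr_ctx_nth (G : ctx P) D : tr_ctx G D -> forall n T, nth_error D n = Some T ->
  exists A s, nth_error G n = Some A /\ T = DEl s (tr A).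
Proof.
  induction 1 as [|G D A s _ IH _]; intros [|n] T; simpl; try discriminate.
  - intros [= <-]. eauto.
  - apply IH.
Qed.

Definition codes (T : dk) (A : term) : Prop :=
  (exists s, dk_conv T (DEl s (tr A))) \/ (exists s, A = Srt s /\ dk_conv T (DU s)).

(** [T] encodes both the type [C] found for [t] and the requested type [A], and reflecting this
    conversion permits [ty_conv]. In the mixed cases an [El] has collapsed to a [U], so its argument
    is convertible to a sort. *)
Lemma typed_codes (G : ctx P) T A C t : wf G ->
  ((exists s, typed G A (Srt s) /\ dk_conv T (DEl s (tr A))) \/
   (exists s, A = Srt s /\ dk_conv T (DU s))) ->
  codes T C -> typed G t C -> typed G t A.
Proof.
  intros Hwf [(s & HA & H1)|(s & -> & H1)] [(s' & H2)|(s' & -> & H2)] Ht;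
    apply dk_conv_sym in H2; assert (H := dk_conv_trans _ _ _ H2 H1).
  - eapply ty_conv; eauto. now apply tr_reflects_conv, (El_inj s' s).
  - eapply ty_conv; eauto. apply dk_conv_sym, El_conv_U in H as [_ H].
    now apply tr_reflects_conv, dk_conv_sym.
  (* The collapse also yields the axiom that types the sort [A], as the conversion rule requires. *)
  - apply El_conv_U in H as [Hax H]. eapply ty_conv; eauto using ty_sort.
    now apply tr_reflects_conv.
  (* Top-sorts end here: having no type, they cannot be the target of [ty_conv], and equality of the
     sorts takes its place. *)
  - apply U_inj in H. now subst.
Qed.

Definition normal (t : dk) : Prop := ~ exists u, dk_beta t u.

Lemma normal_Pi_is_Lam D N T : oty D N T ->
  (forall n U, nth_error D n = Some U -> exists s A, U = DEl s A) -> normal N ->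
  forall A B, dk_conv T (DPi A B) -> exists U M, N = DLam U M.
Proof.
  induction 1; intros HD HN X Y HT; eauto using dk_conv_trans.
  - destruct (HD _ _ H) as (s & C & ->). now apply dk_conv_sym, Pi_not_El in HT.
  (* The head of an application has a product type itself, so it is an abstraction and the
     application is a redex. *)
  - destruct (IHoty1 HD) with A B as (U & M' & ->).
    + intros [u Hu]. apply HN. eexists. apply cc_App1, Hu.
    + apply dk_conv_refl.
    + destruct HN. eexists. apply cc_root. constructor.
  - now apply dk_conv_sym, Pi_not_U in HT.
  - now apply dk_conv_sym, Pi_not_U in HT.
  - now apply dk_conv_sym, Pi_not_El in HT.
  - now apply dk_conv_sym, Pi_not_El in HT.
Qed.

(** Every [dk_red] step in an annotation is a hidden step, so annotations may be exchanged up to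
    full conversion. This trades the annotation of the normal form for the one written by the
    translation. *)
Lemma hidden_conv_Lam (A A' M M' : dk) :
  dk_conv A A' -> hidden_conv M M' -> hidden_conv (DLam A M) (DLam A' M').
Proof.
  intros HA HM. apply rst_trans with (DLam A' M).
  - induction HA; [|apply rst_refl|now apply rst_sym|eapply rst_trans; eauto].
    apply rst_step, cc_root. now constructor.
  - apply cconv_Lam; [apply rst_refl | exact HM].
Qed.

Lemma hidden_conv_dk_conv (t u : dk) : hidden_conv t u -> dk_conv t u.
Proof.
  assert (Hs : forall t u : dk, hidden_step t u -> dk_red t u).
  { unfold dk_red. induction 1; auto using ctx_closure. destruct H. now apply cc_Lam1. }
  induction 1; [apply rst_step, Hs | apply rst_refl | apply rst_sym | eapply rst_trans]; eauto.
Qed.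

(** The induction jumps from [DProd s1 s2 X (DLam U B)] straight to [B]; the abstraction in between
    has a product type, to which the induction hypothesis does not apply. Hence a size in place of
    structural induction. *)
Fixpoint dsize (t : dk) : nat :=
  match t with
  | DPi A B | DLam A B | DApp A B | DProd _ _ A B => S (dsize A + dsize B)
  | DEl _ A => S (dsize A)
  | Dabs _ _ A B M => S (dsize A + dsize B + dsize M)
  | Dapp _ _ A B M N => S (dsize A + dsize B + dsize M + dsize N)
  | _ => 1
  end.

Ltac normal_subterm lem :=
  let u := fresh in let Hu := fresh in
  intros [u Hu];
  match goal with Hnf : normal _ |- _ => solve [apply Hnf; eexists; apply lem, Hu] end.

(** [T] is only convertible to the encoding of [A]: the types of subterms mention pieces of the
    normal form, such as [DEl s1 X], and these agree with the translations of their inverses up to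
    hidden conversion only. *)
Lemma normal_untr n : forall N, dsize N <= n -> normal N ->
  forall (G : ctx P) D T A, tr_ctx G D -> oty D N T ->
  ((exists s, typed G A (Srt s) /\ dk_conv T (DEl s (tr A))) \/
   (exists s, A = Srt s /\ dk_conv T (DU s))) ->
  invertible N /\ typed G (untr N) A /\ hidden_conv N (tr (untr N)).
Proof.
  induction n as [|n IH]; intros N Hn Hnf G D T A HD HN HT; [destruct N; simpl in Hn; lia|].
  assert (Hwf := tr_ctx_wf _ _ HD).
  assert (HDEl : forall n U, nth_error D n = Some U -> exists s A, U = DEl s A).
  { intros m U HU. destruct (tr_ctx_nth _ _ HD _ _ HU) as (? & ? & _ & ->). eauto. }
  assert (Hdom : forall s1 X, dsize X <= n -> normal X -> oty D X (DU s1) ->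
    invertible X /\ typed G (untr X) (Srt s1) /\ hidden_conv X (tr (untr X))).
  { intros s1 X HX HnX HtX. eapply IH; eauto. right. eauto using dk_conv_refl. }
  (* An argument of product type is an abstraction. Its annotation [U] is convertible to [El] of the
     translated inverse of the domain [X], so its body can be retyped in a context to which
     [tr_ctx_cons] applies. *)
  assert (Hbody : forall s1 X B V, dsize B <= n -> normal B ->
    typed G (untr X) (Srt s1) -> hidden_conv X (tr (untr X)) ->
    oty D B (DPi (DEl s1 X) V) ->
    exists U B', B = DLam U B' /\ dk_conv U (DEl s1 (tr (untr X))) /\
      oty (DEl s1 (tr (untr X)) :: D) B' V /\ dsize B' <= n /\ normal B').
  { intros s1 X B V HsB HnB HtX HhX HB.
    destruct (normal_Pi_is_Lam _ _ _ HB HDEl HnB _ _ (dk_conv_refl _)) as (U & B' & ->).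
    apply oty_inv in HB as (V' & HB & HPi). apply Pi_inj in HPi as [HU HV].
    assert (HU' : dk_conv U (DEl s1 (tr (untr X)))).
    { eapply dk_conv_trans; [apply dk_conv_sym, HU|].
      apply cconv_El. now apply hidden_conv_dk_conv. }
    exists U, B'. repeat split; auto.
    - eapply oty_ctx_conv; [|exact HU']. eapply oty_conv; eauto using dk_conv_sym.
    - simpl in HsB. lia.
    - intros [u Hu]. apply HnB. eexists. apply cc_Lam2, Hu. }
  assert (Hfin := fun C t => typed_codes G T A C t Hwf HT).
  assert (Hcod : forall B s1 s2 X, tr_ctx (X :: G) (DEl s1 (tr X) :: D) ->
    dsize B <= n -> normal B -> oty (DEl s1 (tr X) :: D) B (DU s2) ->
    invertible B /\ typed (X :: G) (untr B) (Srt s2) /\ hidden_conv B (tr (untr B))).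
  { intros B s1 s2 X HD' HsB HnB HB. eapply IH; eauto. right. eauto using dk_conv_refl. }
  destruct N; apply oty_inv in HN; try contradiction; simpl in Hn.
  - destruct HN as (U & HU & HTU).
    destruct (tr_ctx_nth _ _ HD _ _ HU) as (C & s & HC & ->).
    repeat split; [constructor | | apply rst_refl].
    apply (Hfin (ren (Nat.add (S n0)) C)); [|now apply ty_var].
    left. exists s. rewrite tr_ren. exact HTU.
  - exfalso. destruct HN as (B & _ & HPi).
    destruct HT as [(s & _ & HT)|(s & _ & HT)];
      [eapply Pi_not_El | eapply Pi_not_U]; eauto using dk_conv_trans, dk_conv_sym.
  - exfalso. destruct HN as (A0 & B & HM & _ & _).
    destruct (normal_Pi_is_Lam _ _ _ HM HDEl) with A0 B as (U & M' & ->);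
      [normal_subterm cc_App1 | apply dk_conv_refl |].
    apply Hnf. eexists. apply cc_root. constructor.
  - destruct HN as (s2 & Hax & HTU). repeat split; [constructor | | apply rst_refl].
    apply (Hfin (Srt s2)); [|now apply ty_sort]. right. eauto.
  - destruct HN as (s3 & Hru & HX & HB & HTU).
    destruct (Hdom s1 N1) as (Hi1 & Ht1 & Hh1); auto; [lia | normal_subterm cc_Prod1 |].
    destruct (Hbody s1 N1 N2 (DU s2)) as (U & B' & -> & HU & HB' & HsB' & HnB');
      auto; [lia | normal_subterm cc_Prod2 |].
    assert (HD' := tr_ctx_cons HD Ht1).
    destruct (Hcod _ _ _ _ HD' HsB' HnB' HB') as (Hi2 & Ht2 & Hh2).
    repeat split; simpl; [now constructor | |].
    + apply (Hfin (Srt s3)); [right; eauto | eapply ty_prod; eauto].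
    + apply cconv_Prod; auto. now apply hidden_conv_Lam.
  - destruct HN as (s3 & Hru & HX & HB & HM & HTU).
    destruct (Hdom s1 N1) as (Hi1 & Ht1 & Hh1); auto; [lia | normal_subterm cc_abs1 |].
    destruct (Hbody s1 N1 N2 (DU s2)) as (U & B' & -> & HU & HB' & HsB' & HnB');
      auto; [lia | normal_subterm cc_abs2 |].
    destruct (Hbody _ N1 N3 _ ltac:(lia) ltac:(normal_subterm cc_abs3) Ht1 Hh1 HM)
      as (V & M' & -> & HV & HM' & HsM' & HnM').
    assert (HD' := tr_ctx_cons HD Ht1).
    destruct (Hcod _ _ _ _ HD' HsB' HnB' HB') as (Hi2 & Ht2 & Hh2).
    destruct (IH M' HsM' HnM' _ _ _ (untr B') HD' HM') as (Hi3 & Ht3 & Hh3).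
    (* The signature gives the body the type [El] of [B x]; with [B] the abstraction over [B'], one
       beta step restores [B'], which is hidden-convertible to the translation of its inverse. *)
    { left. exists s2. split; auto. apply cconv_El.
      apply dk_conv_trans with B'; [|now apply hidden_conv_dk_conv].
      eapply dk_conv_trans; [apply dk_conv_beta|].
      unfold dsubst1. rewrite dsubst_dren, dsubst_id; [apply dk_conv_refl|].
      now intros [|m]. }
    repeat split; simpl; [now constructor | |].
    + apply (Hfin (Pi s1 s2 (untr N1) (untr B'))); [|eapply ty_abs; eauto].
      left. exists s3. eapply dk_conv_trans; [exact HTU|]. simpl.
      apply cconv_El, hidden_conv_dk_conv, cconv_Prod; auto. now apply hidden_conv_Lam.
    + apply cconv_abs; auto; now apply hidden_conv_Lam.
  - destruct HN as (s3 & Hru & HX & HB & HM & HN & HTU).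
    destruct (Hdom s1 N1) as (Hi1 & Ht1 & Hh1); auto; [lia | normal_subterm cc_app1 |].
    destruct (Hbody s1 N1 N2 (DU s2)) as (U & B' & -> & HU & HB' & HsB' & HnB');
      auto; [lia | normal_subterm cc_app2 |].
    assert (HD' := tr_ctx_cons HD Ht1).
    destruct (Hcod _ _ _ _ HD' HsB' HnB' HB') as (Hi2 & Ht2 & Hh2).
    destruct (IH N3 ltac:(lia) ltac:(normal_subterm cc_app3) _ _ _
      (Pi s1 s2 (untr N1) (untr B')) HD HM) as (Hi3 & Ht3 & Hh3).
    { left. exists s3. split; [eapply ty_prod; eauto|].
      apply cconv_El, hidden_conv_dk_conv, cconv_Prod; auto. now apply hidden_conv_Lam. }
    destruct (IH N4 ltac:(lia) ltac:(normal_subterm cc_app4) _ _ _ (untr N1) HD HN)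
      as (Hi4 & Ht4 & Hh4).
    { left. exists s1. split; auto. now apply cconv_El, hidden_conv_dk_conv. }
    repeat split; simpl; [now constructor | |].
    + apply (Hfin (subst1 (untr N4) (untr B'))); [|eapply ty_app; eauto].
      (* Hidden conversion turns body and argument into translations while [U] stays in place; one
         beta step then matches the translation of the substituted type. *)
      left. exists s2. eapply dk_conv_trans; [exact HTU|]. apply cconv_El.
      rewrite tr_subst1. eapply dk_conv_trans; [|apply (dk_conv_beta U)].
      apply hidden_conv_dk_conv, cconv_App; auto.
      apply cconv_Lam; [apply rst_refl | exact Hh2].
    + apply cconv_app; auto. now apply hidden_conv_Lam.
Qed.

End Conservativity.

Theorem mainTheorem3 (P : pts_spec) (HP : functional_spec P)
    (G : ctx P) (A : term P) (D : dkctx P) (M T : dk P) :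
  is_type G A ->
  tr_ctx G D ->
  ((exists sA : sort P, typed G A (Srt P sA) /\ T = DEl sA (tr A)) \/
   (exists s : sort P, A = Srt P s /\ T = DU P s)) ->
  dtyped D M T ->
  exists N : dk P,
    unique (beta_nf_of M) N /\
    invertible N /\
    typed G (untr N) A /\
    clos_refl_trans (dk P) (@dk_beta P) M N /\
    hidden_conv N (tr (untr N)).
Proof.
  intros _ HD HT HM.
  destruct (dtyped_has_nf _ _ _ _ HM) as [N HN].
  destruct HN as [[HMN Hnf] Huniq].
  (* [T] is a family in both cases, so [M] is an object and its typing passes to [oty]. *)
  assert (Hobj : has_level P Obj M).
  { apply (dtyped_levels P) in HM as (_ & HL & _). apply (typing_levels_Fam _ _ _ HL).
    destruct HT as [(s & _ & ->)|(s & _ & ->)]; simpl; auto using tr_Obj. }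
  destruct (normal_untr P (dsize P N) N (le_n _) Hnf G D T A HD) as (Hi & Ht & Hh).
  - eapply oty_betas; eauto. now apply dtyped_oty.
  - destruct HT as [(s & HA & ->)|(s & -> & ->)]; [left | right]; exists s;
      split; auto; apply rst_refl.
  - exists N. repeat split; auto.
Qed.
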